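(* Let $T$ be a countable Markov map with inverse branches $(f_i)_{i\in\mathbb N}$ such that the potential $-\log|T'|$ has summable variations. Let $(T_k)_{k\in\mathbb N}$ be a sequence of countable Markov maps with inverse branches $(f_{i,k})_{i\in\mathbb N}$, of the same orientation as $T$. Assume: (1) there exists $0<t<1$ with $\sum_{i=1}^\infty |f_i[0,1]|^t<\infty$, where $|\cdot|$ denotes the length of an interval; (2) the potentials $-\log|T_k'|$ have summable variations with a uniform bound over $k$: $$\sup_{k\in\mathbb N}\sum_{n=1}^\infty \mathrm{var}_n(-\log|T_k'|)<\infty .$$ Let $\theta_k:[0,1]\to[0,1]$ be the topological conjugacy between $T_k$ and $T$. If for every $i\in\mathbb N$ one has $f_{i,k}\to f_i$ pointwise on $[0,1]$ as $k\to\infty$, then $$\lim_{k\to\infty}\dim_{\mathrm H}\{x\in[0,1]:\theta_k'(x)\neq 0\}=1 .$$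
   Context: A countable Markov map $T:[0,1]\to[0,1]$ is given by inverse branches $f_i:[0,1]\to[0,1]$, $i\in\mathbb N=\{1,2,\dots\}$, which are $C^1$ and strictly monotone, and satisfy one of the following two conditions (the orientation): - decreasing case: all $f_i$ are strictly decreasing, $f_1(0)=1$, $f_{i+1}(0)=f_i(1)$ for all $i$, and $f_i(0)$ decreases to $0$ as $i\to\infty$; - increasing case: all $f_i$ are strictly increasing, $f_1(1)=1$, $f_{i+1}(1)=f_i(0)$ for all $i$, and $f_i(1)$ decreases to $0$ as $i\to\infty$. Moreover there exist $m\in\mathbb N$ and $\xi<1$ (depending on $T$) with $|(f_{i_1}\circ\cdots\circ f_{i_m})'(x)|\le\xi$ for all $(i_1,\dots,i_m)\in\mathbb N^m$ and $x\in(0,1)$. The map is $T(x)=f_i^{-1}(x)$ for $x\in f_i([0,1))$ and $T(0)=0$ (and $T(1)=1$ in the increasing case). Let $\Sigma=\mathbb N^{\mathbb N}$ with left shift $\sigma$, let $[\mathbf i]\subset\Sigma$ be the cylinder of sequences starting with the finite word $\mathbf i$, and let $\pi_T(i_1,i_2,\dots)=\lim_{n\to\infty}f_{i_1}\circ\cdots\circ f_{i_n}(0)$. The potential $-\log|T'|$ is regarded as the function on $\Sigma$ given by $\phi(\mathbf i)=-\log|T'(\pi_T(\mathbf i))|=\log|f_{i_1}'(\pi_T(\sigma\mathbf i))|$ (assumed finite). For $n\ge1$, $\mathrm{var}_n(\phi)=\sup_{\mathbf i\in\mathbb N^n}\sup\{|\phi(\mathbf j)-\phi(\mathbf k)|:\mathbf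 j,\mathbf k\in[\mathbf i]\}$, and $\phi$ has summable variations if $\sum_{n\ge1}\mathrm{var}_n(\phi)<\infty$. The topological conjugacy $\theta_k$ between $T_k$ and $T$ is the increasing homeomorphism of $[0,1]$ with $T\circ\theta_k=\theta_k\circ T_k$ that matches codings: $\theta_k\circ\pi_{T_k}=\pi_T$ on $\Sigma$, equivalently $\theta_k\circ f_{i,k}=f_i\circ\theta_k$ for all $i$. The set $\{x:\theta_k'(x)\ne0\}$ is the set of $x$ for which it is not the case that $\theta_k'(x)$ exists and equals $0$; it thus includes points where the derivative does not exist or is infinite. $\dim_{\mathrm H}$ is Hausdorff dimension. *)

(* Defs.v *)
From HB Require Import structures.
From mathcomp Require Import all_boot all_order all_algebra.
From mathcomp Require Import all_classical all_reals all_analysis.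

Set Implicit Arguments.
Unset Strict Implicit.
Unset Printing Implicit Defensive.

Import Order.TTheory GRing.Theory Num.Theory.
Import numFieldNormedType.Exports.

Local Open Scope classical_set_scope.
Local Open Scope ring_scope.

(* Functions on [0,1] are total functions R -> R of which only the values on
   [0,1] are relevant.  Their difference quotients are therefore restricted to
   [0,1], which makes the derivative one-sided at 0 and at 1, and the usual
   two-sided derivative on ]0,1[. *)
Definition has_deriv01 (R : realType) (g : R -> R) (x l : R) : Prop :=
  (g y - g x) / (y - x) @[y --> within `[0, 1] x^'] --> l.

Definition deriv01 (R : realType) (g : R -> R) (x : R) : R :=
  lim ((g y - g x) / (y - x) @[y --> within `[0, 1] x^']).

Definition C1_01 (R : realType) (g : R -> R) : Prop :=
  (forall x : R, x \in `[0, 1] -> exists l, has_deriv01 g x l) /\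
  {within `[0, 1], continuous (deriv01 g)}.

(* f_{i_1} \o ... \o f_{i_n} for w = [:: i_1; ...; i_n] *)
Definition comp_word (R : realType) (f : nat -> R -> R) (w : seq nat) : R -> R :=
  foldr (fun i g => f i \o g) id w.

Variant orientation := Decreasing | Increasing.

(* The alphabet {1, 2, ...} is represented by nat: f i is the (i+1)-st branch. *)
Definition oriented (R : realType) (o : orientation) (f : nat -> R -> R) : Prop :=
  match o with
  | Decreasing =>
    [/\ forall i, {in `[0, 1] &, {homo f i : x y / x < y >-> y < x}},
        f 0%N 0 = 1,
        forall i, f i.+1 0 = f i 1,
        decreasing_seq (fun i => f i 0) &
        f i 0 @[i --> \oo] --> (0 : R)]
  | Increasing =>
    [/\ forall i, {in `[0, 1] &, {homo f i : x y / x < y}},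
        f 0%N 1 = 1,
        forall i, f i.+1 1 = f i 0,
        decreasing_seq (fun i => f i 1) &
        f i 1 @[i --> \oo] --> (0 : R)]
  end.

Record countable_markov_map (R : realType) (o : orientation)
    (T : R -> R) (f : nat -> R -> R) : Prop := CountableMarkovMap {
  branch_maps : forall i (x : R), x \in `[0, 1] -> f i x \in `[0, 1] ;
  branch_C1 : forall i, C1_01 (f i) ;
  branch_oriented : oriented o f ;
  branch_contraction : exists (m : nat) (xi : R), [/\ (0 < m)%N, xi < 1 &
    forall (w : m.-tuple nat) (x : R), x \in `]0, 1[ ->
      `|deriv01 (comp_word f w) x| <= xi] ;
  markov_branch : forall i (x : R), x \in `[0, 1[ -> T (f i x) = x ;
  markov_at0 : T 0 = 0 ;
  markov_at1 : o = Increasing -> T 1 = 1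
}.

Definition shift_seq (w : nat -> nat) : nat -> nat := fun n => w n.+1.

Definition coding (R : realType) (f : nat -> R -> R) (w : nat -> nat) : R :=
  lim (comp_word f (mkseq w n) 0 @[n --> \oo]).

(* - log |T'| on the symbolic space.  It is written with the derivative of the
   branch since T is discontinuous at the endpoints of the intervals f_i[0,1],
   and some of these are coded in the increasing case. *)
Definition potential (R : realType) (f : nat -> R -> R) (w : nat -> nat) : R :=
  ln `|deriv01 (f (w 0%N)) (coding f (shift_seq w))|.

(* Needed because ln 0 = 0 in the library. *)
Definition finite_potential (R : realType) (f : nat -> R -> R) : Prop :=
  forall w : nat -> nat, deriv01 (f (w 0%N)) (coding f (shift_seq w)) != 0.

Definition cylinder (u : seq nat) : set (nat -> nat) :=
  [set w | mkseq w (size u) = u].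

Definition var_n (R : realType) (n : nat) (phi : (nat -> nat) -> R) : \bar R :=
  ereal_sup [set ereal_sup [set `|phi jk.1 - phi jk.2|%:E
                           | jk in cylinder u `*` cylinder u]
            | u in [set: n.-tuple nat]].

Definition sum_variations (R : realType) (phi : (nat -> nat) -> R) : \bar R :=
  (\sum_(1 <= n <oo) var_n n phi)%E.

Definition summable_variations (R : realType) (phi : (nat -> nat) -> R) : Prop :=
  (sum_variations phi < +oo)%E.

Definition increasing_homeo01 (R : realType) (h : R -> R) : Prop :=
  {in `[0, 1] &, {homo h : x y / x < y}} /\
  exists g : R -> R,
    [/\ forall x, x \in `[0, 1] -> h x \in `[0, 1] /\ g x \in `[0, 1],
        {in `[0, 1], cancel h g},
        {in `[0, 1], cancel g h},
        {within `[0, 1], continuous h} &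
        {within `[0, 1], continuous g}].

(* h is the topological conjugacy from (S, g) to (T, f). *)
Definition conjugacy (R : realType) (S : R -> R) (g : nat -> R -> R)
    (T : R -> R) (f : nat -> R -> R) (h : R -> R) : Prop :=
  [/\ increasing_homeo01 h,
      {in `[0, 1], forall x, T (h x) = h (S x)} &
      forall w : nat -> nat, h (coding g w) = coding f w].

Definition diam (R : realType) (A : set R) : \bar R :=
  ereal_sup [set `|p.1 - p.2|%:E | p in A `*` A].

(* diam(A)^s, where the empty set has gauge 0 for every s (including s = 0) and
   a nonempty set has gauge diam(A)^0 = 1 for s = 0. *)
Definition diam_pow (R : realType) (s : R) (A : set R) : \bar R :=
  if `[< A = set0 >] then 0%E else poweR (diam A) s.

Definition hausdorff_content (R : realType) (s delta : R) (E : set R) : \bar R :=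
  ereal_inf [set (\sum_(0 <= i <oo) diam_pow s (U i))%E
            | U in [set U : nat -> set R |
                (forall i, (diam (U i) <= delta%:E)%E) /\
                E `<=` \bigcup_i U i]].

Definition hausdorff_measure (R : realType) (s : R) (E : set R) : \bar R :=
  ereal_sup [set hausdorff_content s delta E | delta in [set d : R | 0 < d]].

Definition hausdorff_dim (R : realType) (E : set R) : \bar R :=
  ereal_inf [set s%:E
            | s in [set s : R | 0 <= s /\ hausdorff_measure s E = 0%E]].

(* Main.v *)
(** Write [a u], [b u] for the lengths of the cylinder of the word [u] for [T]
    and for [T_k]; [theta_k] maps the second cylinder onto the first.  If [x]
    lies in arbitrarily small cylinders of [T_k] with [b u <= M * a u], then
    [theta_k] does not have derivative 0 at [x].  Summable variations give
    bounded distortion, uniformly in [k]: [a (u v)] is [a u * a v] up to a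
    constant factor, and likewise for [b].

    Suppose first that [b j < c * a j ^ 2] for some letter [j].  Then inserting [j]
    between long strings of words for which [a] and [b] almost agree makes [b]
    smaller than [a], at a cost negligible for the dimension of the resulting
    Cantor set, which is close to 1.

    Otherwise [b j >= c * a j ^ 2] for all [j], and Lebesgue measure in the
    coordinate [y = theta_k x] works.  The cylinders with [b u > 4 * a u] have
    small total [a]-length.  Since the [a j] have a finite sum of [t]-th powers,
    the sum of [a v * (a v ^ tau / b v) ^ delta] over the words of a fixed large
    length is close to that for [b = a], hence small, so by a Chernoff bound
    [b (u v) >= c1 * a u ^ tau] holds along all prefixes outside a set of small
    measure.  On the remaining points [theta_k] is Hoelder with exponent
    [1 / tau] in a one-sided sense, and the mass distribution principle gives
    dimension at least [1 / tau]. *)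

Require Import Defs.
From mathcomp Require Import all_boot all_order all_algebra.
From mathcomp Require Import all_classical all_reals all_analysis.
From mathcomp Require Import ring lra zify.

Set Implicit Arguments.
Unset Strict Implicit.
Unset Printing Implicit Defensive.

Import Order.TTheory GRing.Theory Num.Theory.
Import numFieldNormedType.Exports.

Local Open Scope classical_set_scope.
Local Open Scope ring_scope.

(** * Difference quotients on [0, 1] *)

(** Convergence is pointwise for each branch, so for a given [k] only finitely many words are known
    to have comparable lengths for [T] and [T_k]; far letters of [T_k] are uncontrolled. All
    constants and lists of test words must therefore be fixed before [k], while the case distinction
    and the letter [j] may depend on [k].

    The square in the dichotomy serves both cases. Let [a], [b] be the lengths of the letter [j]. If
    [b < a ^ 2 / Q] for a constant [Q], take [l] maximal with [Q ^ l * b <= a]. One [j] then makes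
    up for a loss of [Q] in each of [l] words, and [b >= Q ^ (- 4 * l)]: the cost of [j], shared
    among these words, is bounded independently of [j]. If [b >= c * a ^ 2], then [a / b ^ delta] is
    at most a constant times [a ^ (1 - 2 * delta)], and [delta = (1 - t) / 2] turns this into the
    summable [a ^ t].

    In both cases the measure is carried by a parametrization [p] defined on [[0, 1]] with Lebesgue
    measure, so no measure has to be constructed on the fractal set itself. *)

Section UnitInterval.
Context {R : realType}.
Implicit Types (g : R -> R) (x y l : R).

Lemma dnbhs_ballP x (P : set R) :
  x^' P <-> exists2 d, 0 < d & forall y, ball x d y -> y != x -> P y.
Proof.
rewrite /dnbhs /within /=; split=> [/nbhs_ballP[d /= d0 H]|[d d0 H]].
  by exists d.
by apply/nbhs_ballP; exists d.
Qed.

Lemma has_deriv01P g x l :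
  has_deriv01 g x l <->
  forall e, 0 < e -> exists2 d, 0 < d &
    forall y, y \in `[0, 1] -> y != x -> `|y - x| < d ->
      `|(g y - g x) / (y - x) - l| < e.
Proof.
split=> [/cvgrPdist_lt gl e e0|gl].
- have := gl e e0; rewrite /within /= => /dnbhs_ballP [d /= d0 H].
  exists d => // y y01 yx yd.
  by rewrite distrC; apply: H => //; rewrite /ball /= distrC.
- apply/cvgrPdist_lt => e /gl[d d0 H].
  rewrite /within /=; apply/dnbhs_ballP; exists d => //= y yd yx y01.
  by rewrite distrC; apply: H => //; rewrite distrC.
Qed.

Lemma continuous01P g :
  {within `[0, 1], continuous g} <->
  forall x, x \in `[0, 1] -> forall e, 0 < e -> exists2 d, 0 < d &
    forall y, y \in `[0, 1] -> `|y - x| < d -> `|g y - g x| < e.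
Proof.
split=> [/subspace_continuousP gc x x01 e e0|gc].
- have /cvgrPdist_lt /(_ e e0) := gc x x01.
  rewrite /within /= => /nbhs_ballP [d /= d0 H].
  by exists d => // y y01 yd; rewrite distrC; apply: H => //; rewrite /ball /= distrC.
- apply/subspace_continuousP => x x01; apply/cvgrPdist_lt => e e0.
  have [d d0 H] := gc x x01 e e0.
  rewrite /within /=; apply/nbhs_ballP; exists d => //= y yd y01.
  by rewrite distrC; apply: H => //; rewrite distrC.
Qed.

Lemma deriv01_continuous g x : (exists l, has_deriv01 g x l) ->
  forall e, 0 < e -> exists2 d, 0 < d &
    forall y, y \in `[0, 1] -> `|y - x| < d -> `|g y - g x| < e.
Proof.
move=> [l /has_deriv01P/(_ 1 ltr01) [d d0 H]] e e0.
have l0 : 0 < `|l| + 1 by rewrite ltr_wpDl.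
exists (Num.min d (e / (`|l| + 1))); first by rewrite lt_min d0 divr_gt0.
move=> y y01; rewrite lt_min => /andP[yd ye].
have [->|yx] := eqVneq y x; first by rewrite subrr normr0.
have yx0 : y - x != 0 by rewrite subr_eq0.
have {}H := H y y01 yx yd.
have -> : g y - g x = (g y - g x) / (y - x) * (y - x) by rewrite divfK.
rewrite normrM; apply: (@le_lt_trans _ _ ((`|l| + 1) * `|y - x|)).
  rewrite ler_wpM2r// -(subrK l ((g y - g x) / (y - x))).
  by rewrite (le_trans (ler_normD _ _))// addrC lerD2l ltW.
by rewrite mulrC -ltr_pdivlMr.
Qed.

Lemma C1_01_continuous g : C1_01 g -> {within `[0, 1], continuous g}.
Proof. by move=> [gd _]; apply/continuous01P => x /gd /deriv01_continuous. Qed.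

Lemma C1_01_has_deriv g x : C1_01 g -> x \in `[0, 1] ->
  has_deriv01 g x (deriv01 g x).
Proof. by move=> [gd _] /gd[l] /cvgP. Qed.

Lemma has_deriv01_is_derive g x l : x \in `]0, 1[ ->
  has_deriv01 g x l <-> is_derive x 1 g l.
Proof.
rewrite in_itv/= => /andP[x0 x1].
have near01 : exists2 d, 0 < d & forall h : R, `|h| < d -> h + x \in `[0, 1].
  exists (Num.min x (1 - x)); first by rewrite lt_min x0 subr_gt0.
  move=> h; rewrite lt_min !ltr_norml in_itv/= => /andP[/andP[? ?] /andP[? ?]].
  by lra.
split.
- move=> /has_deriv01P gl.
  have cg : h^-1 *: (g (h *: 1 + x) - g x) @[h --> 0^'] --> l.
    apply/cvgrPdist_lt => e /gl [d d0 H].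
    have [d' d'0 H'] := near01.
    apply/dnbhs_ballP; exists (Num.min d d') => /=; first by rewrite lt_min d0.
    move=> h; rewrite /ball /= sub0r normrN lt_min => /andP[hd hd'] h0.
    have := H (h + x) (H' _ hd').
    rewrite addrK -subr_eq0 addrK => /(_ h0 hd).
    by rewrite distrC scaler1 /GRing.scale/= mulrC.
  apply: DeriveDef; first by apply: (cvgP l); exact: cg.
  by rewrite /derive; apply: cvg_lim.
- move=> [gd gl]; apply/has_deriv01P => e e0.
  have : h^-1 *: (g (h *: 1 + x) - g x) @[h --> 0^'] --> l by rewrite -gl.
  move=> /cvgrPdist_lt /(_ e e0) /dnbhs_ballP [d /= d0 H].
  exists d => // y y01 yx yd.
  have := H (y - x); rewrite /ball /= sub0r normrN => /(_ yd).
  rewrite subr_eq0 => /(_ yx).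
  by rewrite distrC scaler1 subrK /GRing.scale/= mulrC.
Qed.

Lemma deriv01_is_derive g x l : x \in `]0, 1[ -> is_derive x 1 g l ->
  deriv01 g x = l.
Proof.
move=> x01 gl; have /(has_deriv01_is_derive _ _ x01).2 gl' := gl.
(* Uniqueness of the limit needs a proper filter: [[0, 1]] has points other than [x] arbitrarily
   close to [x]. *)
have xl : ProperFilter (within `[0, 1] x^').
  apply: Build_ProperFilter_ex => P; rewrite /within /= => /dnbhs_ballP[d /= d0 H].
  move: x01; rewrite in_itv/= => /andP[x0 x1].
  pose h := Num.min (d / 2) ((1 - x) / 2).
  have h0 : 0 < h by rewrite lt_min !divr_gt0// subr_gt0.
  have hd : h <= d / 2 by rewrite ge_min lexx.
  have hx : h <= (1 - x) / 2 by rewrite ge_min lexx orbT.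
  exists (x + h); apply: H => /=.
  - rewrite /ball/= opprD addNKr normrN gtr0_norm//; lra.
  - by rewrite -subr_eq0 addrAC subrr add0r gt_eqF.
  - by rewrite in_itv/=; lra.
exact: (cvg_lim _ gl').
Qed.

Lemma C1_01_MVT g x y : C1_01 g -> 0 <= x -> x < y -> y <= 1 ->
  exists2 z, x < z < y & g y - g x = deriv01 g z * (y - x).
Proof.
move=> gC x0 xy y1.
have [||z zxy E] := @MVT R g (deriv01 g) x y xy.
- move=> z; rewrite in_itv/= => /andP[xz zy].
  have z01 : z \in `]0, 1[ by rewrite in_itv/=; lra.
  apply/(has_deriv01_is_derive g _ z01)/C1_01_has_deriv => //.
  by rewrite in_itv/=; lra.
- apply: continuous_subspaceW (C1_01_continuous gC).
  by move=> z /=; rewrite !in_itv/= => /andP[? ?]; lra.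
by exists z => //; move: zxy; rewrite in_itv.
Qed.

(** The potential sees derivatives only at coded points, and 0, for one, is never coded. Coded
    points are dense, so this carries inequalities from them to all of [[0, 1]]; the conjugacy
    equation for words is obtained in the same way. *)
Lemma continuous01_le_dense (D : set R) g (h : R -> R) :
  {within `[0, 1], continuous g} -> {within `[0, 1], continuous h} ->
  (forall x e, x \in `[0, 1] -> 0 < e -> exists y, [/\ D y, y \in `[0, 1] & `|y - x| < e]) ->
  (forall x, D x -> x \in `[0, 1] -> g x <= h x) ->
  forall x, x \in `[0, 1] -> g x <= h x.
Proof.
move=> /continuous01P gc /continuous01P hc Dd gh x x01.
rewrite leNgt; apply/negP => hg.
have e0 : 0 < (g x - h x) / 2 by rewrite divr_gt0// subr_gt0.
have [d d0 Hd] := gc x x01 _ e0; have [d' d'0 Hd'] := hc x x01 _ e0.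
have [|y [Dy y01]] := Dd x (Num.min d d') x01; first by rewrite lt_min d0.
rewrite lt_min => /andP[/(Hd y y01) yd /(Hd' y y01) yd'].
have := gh y Dy y01; move: yd yd'; rewrite !ltr_norml => /andP[? ?] /andP[? ?] ?.
lra.
Qed.

End UnitInterval.

Definition strictly_monotone01 (R : realType) (g : R -> R) : Prop :=
  {in `[0, 1] &, {homo g : x y / x < y}} \/
  {in `[0, 1] &, {homo g : x y / x < y >-> y < x}}.

Definition cylinder_length (R : realType) (f : nat -> R -> R) (u : seq nat) : R :=
  `|comp_word f u 1 - comp_word f u 0|.

(** In either orientation branch [i] maps onto the interval from [upper_end f i.+1] to
    [upper_end f i]; this sequence spares later arguments a case split on the orientation. *)
Definition upper_end (R : realType) (f : nat -> R -> R) (i : nat) : R :=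
  Num.max (f i 0) (f i 1).

Section StrictlyMonotone.
Context {R : realType}.
Implicit Types (g : R -> R) (x y : R).

Lemma in01 x : (x \in `[0, 1]) = (0 <= x <= 1). Proof. exact: in_itv. Qed.

Lemma in01_0 : (0 : R) \in `[0, 1]. Proof. by rewrite in01 lexx ler01. Qed.
Lemma in01_1 : (1 : R) \in `[0, 1]. Proof. by rewrite in01 lexx ler01. Qed.

Lemma strictly_monotone01_inj g : strictly_monotone01 g ->
  {in `[0, 1] &, injective g}.
Proof.
move=> gm x y x01 y01 gxy; case: (ltgtP x y) => // xy; exfalso.
- by case: gm => gm; have := gm _ _ x01 y01 xy; rewrite gxy ltxx.
- by case: gm => gm; have := gm _ _ y01 x01 xy; rewrite gxy ltxx.
Qed.

Lemma strictly_monotone01_comp g (h : R -> R) :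
  {in `[0, 1], forall x, h x \in `[0, 1]} ->
  strictly_monotone01 g -> strictly_monotone01 h -> strictly_monotone01 (g \o h).
Proof.
move=> h01 [] gm [] hm; [left|right|right|left] => x y x01 y01 xy /=;
  apply: gm; do ?exact: h01; exact: hm.
Qed.

Lemma strictly_monotone01_dist g x y z : strictly_monotone01 g ->
  0 <= x -> x <= y -> y <= z -> z <= 1 ->
  `|g z - g x| = `|g z - g y| + `|g y - g x|.
Proof.
move=> gm x0 xy yz z1.
have x01 : x \in `[0, 1] by rewrite in01; lra.
have y01 : y \in `[0, 1] by rewrite in01; lra.
have z01 : z \in `[0, 1] by rewrite in01; lra.
move: xy yz; rewrite !le_eqVlt => /predU1P[->|xy] /predU1P[<-|yz];
  rewrite ?subrr ?normr0 ?addr0 ?add0r//.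
case: gm => gm; have := gm _ _ x01 y01 xy; have := gm _ _ y01 z01 yz => ? ?.
- by rewrite !ger0_norm ?subr_ge0; lra.
- by rewrite !ler0_norm ?subr_le0; lra.
Qed.

Lemma strictly_monotone01_le g x y : strictly_monotone01 g ->
  x \in `[0, 1] -> y \in `[0, 1] -> `|g x - g y| <= `|g 1 - g 0|.
Proof.
move=> gm; wlog xy : x y / y <= x.
  move=> H x01 y01; case: (leP y x) => [/H|/ltW /H]; first exact.
  by rewrite distrC; apply.
rewrite !in01 => /andP[x0 x1] /andP[y0 y1].
have E1 := strictly_monotone01_dist gm (lexx 0) y0 y1 (lexx 1).
have E2 := strictly_monotone01_dist gm y0 xy x1 (lexx 1).
have := normr_ge0 (g y - g 0); have := normr_ge0 (g 1 - g x); lra.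
Qed.

End StrictlyMonotone.

(** * Cylinders *)

Lemma comp_word_cat (R : realType) (f : nat -> R -> R) u v x :
  comp_word f (u ++ v) x = comp_word f u (comp_word f v x).
Proof. by elim: u => //= i u IH; rewrite /comp_word/= in IH *; rewrite IH. Qed.

Section Cylinders.
Context {R : realType} {o : orientation} {T : R -> R} {f : nat -> R -> R}.
Hypothesis Hf : countable_markov_map o T f.
Implicit Types (u v : seq nat) (x y : R).

Local Notation F := (comp_word f).
Local Notation len := (cylinder_length f).
Local Notation e := (upper_end f).

Lemma branch_strictly_monotone i : strictly_monotone01 (f i).
Proof. by case: o (branch_oriented Hf) => -[fm _ _ _ _]; [right|left]; apply: fm. Qed.

Lemma comp_word01 u : {in `[0, 1], forall x, F u x \in `[0, 1]}.
Proof. by elim: u => //= i u IH x x01; apply: branch_maps Hf _ _ (IH x x01). Qed.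

Lemma comp_word_strictly_monotone u : strictly_monotone01 (F u).
Proof.
elim: u => [|i u IH]; first by left.
exact: strictly_monotone01_comp (@comp_word01 u) (branch_strictly_monotone i) IH.
Qed.

Lemma comp_word_inj u : {in `[0, 1] &, injective (F u)}.
Proof. exact/strictly_monotone01_inj/comp_word_strictly_monotone. Qed.

Lemma comp_word_continuous u : {within `[0, 1], continuous (F u)}.
Proof.
elim: u => [|i u IH].
  by apply/continuous01P => x _ d d0; exists d.
apply/continuous01P => x x01 d d0.
have /continuous01P fc := C1_01_continuous (branch_C1 Hf i).
have [d1 d10 H1] := fc _ (comp_word01 u x01) _ d0.
have [d2 d20 H2] := (continuous01P _).1 IH x x01 _ d10.
by exists d2 => // y y01 yd; apply: H1; [exact: comp_word01|exact: H2].
Qed.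

Lemma len_gt0 u : 0 < len u.
Proof.
rewrite normr_gt0 subr_eq0; apply/eqP => /(comp_word_inj in01_1 in01_0)/eqP.
by rewrite oner_eq0.
Qed.

Lemma len_nil : len [::] = 1.
Proof. by rewrite /cylinder_length /= subr0 normr1. Qed.

Lemma comp_word_dist_le u x y : x \in `[0, 1] -> y \in `[0, 1] ->
  `|F u x - F u y| <= len u.
Proof. exact/strictly_monotone01_le/comp_word_strictly_monotone. Qed.

Lemma len_le1 u : len u <= 1.
Proof.
have := comp_word01 u in01_0; have := comp_word01 u in01_1.
by rewrite !in01 /cylinder_length ler_norml; lra.
Qed.

Lemma comp_word_interval u x y z : x \in `[0, 1] -> y \in `[0, 1] ->
  F u x <= z <= F u y -> exists2 w, w \in `[0, 1] & F u w = z.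
Proof.
move=> x01 y01 /andP[xz zy].
have [xy|yx] := leP x y.
- have [||w wxy <-] := @IVT R (F u) x y z xy.
  + apply: continuous_subspaceW (comp_word_continuous (u := u)).
    by move=> w /=; move: x01 y01; rewrite !in_itv/= => ? ? ?; lra.
  + by rewrite ge_min le_max xz zy orbT.
  exists w => //; move: wxy x01 y01; rewrite !in_itv/= => ? ? ?; lra.
- have [||w wxy <-] := @IVT R (F u) y x z (ltW yx).
  + apply: continuous_subspaceW (comp_word_continuous (u := u)).
    by move=> w /=; move: x01 y01; rewrite !in_itv/= => ? ? ?; lra.
  + by rewrite ge_min le_max xz zy orbT.
  exists w => //; move: wxy x01 y01; rewrite !in_itv/= => ? ? ?; lra.
Qed.

Lemma branch_endsE i : (f i 0 = e i.+1 /\ f i 1 = e i) \/ (f i 0 = e i /\ f i 1 = e i.+1).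
Proof.
rewrite /upper_end; case: o (branch_oriented Hf) => -[fm _ fS _ _].
- have h i' : f i' 1 < f i' 0 by apply: fm in01_0 in01_1 ltr01.
  by right; rewrite !max_l ?ltW// fS.
- have h i' : f i' 0 < f i' 1 by apply: fm in01_0 in01_1 ltr01.
  by left; rewrite !max_r ?ltW// fS.
Qed.

Lemma upper_end0 : e 0 = 1.
Proof.
rewrite /upper_end; case: o (branch_oriented Hf) => -[fm f0 _ _ _].
- by rewrite max_l// ltW//; apply: fm in01_0 in01_1 ltr01.
- by rewrite max_r// ltW//; apply: fm in01_0 in01_1 ltr01.
Qed.

Lemma upper_end_cvg : e n @[n --> \oo] --> (0 : R).
Proof.
case: o (branch_oriented Hf) => -[fm _ _ _].
- suff -> : e = fun n => f n 0 by [].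
  by apply/funext => n; rewrite /upper_end max_l// ltW//; apply: fm in01_0 in01_1 ltr01.
- suff -> : e = fun n => f n 1 by [].
  by apply/funext => n; rewrite /upper_end max_r// ltW//; apply: fm in01_0 in01_1 ltr01.
Qed.

Lemma upper_end01 i : e i \in `[0, 1].
Proof.
by case: (branch_endsE i) => -[_ E];
  [rewrite -E|case: (branch_endsE i) => -[E0 E1]; [rewrite -E1|rewrite -E0]];
  apply: branch_maps Hf _ _ _; rewrite ?in01_0 ?in01_1.
Qed.

Lemma upper_endS_lt i : e i.+1 < e i.
Proof.
rewrite lt_neqAle; apply/andP; split.
  have := len_gt0 [:: i]; rewrite normr_gt0 subr_eq0 /=.
  by case: (branch_endsE i) => -[-> ->]; rewrite // eq_sym.
rewrite {2}/upper_end le_max.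
by case: (branch_endsE i) => -[-> ->]; rewrite lexx ?orbT.
Qed.

Lemma upper_end_le i j : (i <= j)%N -> e j <= e i.
Proof.
elim: j => [|j IH]; first by rewrite leqn0 => /eqP->.
rewrite leq_eqVlt => /predU1P[->//|/IH]; exact/le_trans/ltW/upper_endS_lt.
Qed.

Lemma upper_end_gt0 i : 0 < e i.
Proof.
have := upper_endS_lt i; have := upper_end01 i.+1; rewrite in01; lra.
Qed.

Lemma branch_range i x : x \in `[0, 1] -> e i.+1 <= f i x <= e i.
Proof.
move=> x01; have := comp_word_dist_le [:: i] x01 in01_0.
have := comp_word_dist_le [:: i] x01 in01_1.
rewrite /cylinder_length /=; have := upper_endS_lt i.
by case: (branch_endsE i) => -[-> ->] ?; rewrite !ler_norml; 
  [rewrite ger0_norm|rewrite ler0_norm]; lra.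
Qed.

Lemma branch_interior i x : x \in `]0, 1[ -> e i.+1 < f i x < e i.
Proof.
move=> x01; have x01' : x \in `[0, 1] by move: x01; rewrite !in_itv/=; lra.
have /andP[l r] := branch_range i x01'; rewrite !lt_neqAle l r !andbT.
have fi := strictly_monotone01_inj (branch_strictly_monotone i).
apply/andP; split; apply/eqP => E; move: x01.
- by case: (branch_endsE i) => -[E0 E1]; [move: E; rewrite -E0|move: E; rewrite -E1] =>
  /(fi _ _ _ x01') <-; rewrite ?in01_0 ?in01_1 ?in_itv//= ltxx ?andbF.
- by case: (branch_endsE i) => -[E0 E1]; [move: E; rewrite -E1|move: E; rewrite -E0] =>
  /(fi _ _ x01') ->; rewrite ?in01_0 ?in01_1 ?in_itv//= ltxx ?andbF.
Qed.

Lemma branch_interior01 i x : x \in `]0, 1[ -> f i x \in `]0, 1[.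
Proof.
move=> /(branch_interior i) /andP[l r]; rewrite in_itv/=.
have := upper_end01 i; have := upper_end01 i.+1; rewrite !in01; lra.
Qed.

Lemma comp_word_interior u x : x \in `]0, 1[ -> F u x \in `]0, 1[.
Proof. by move=> x01; elim: u => //= i u; exact: branch_interior01. Qed.

Lemma branch_cover x : 0 < x -> x <= 1 -> exists i y, y \in `[0, 1] /\ f i y = x.
Proof.
move=> x0 x1.
have /ex_minnP[[|n]] : exists n, e n < x.
  have /cvgrPdist_lt/(_ _ x0)[N _ H] := upper_end_cvg.
  exists N; have := H N (leqnn N).
  by rewrite sub0r normrN ger0_norm ?ltW ?upper_end_gt0.
- by rewrite upper_end0 ltNge x1.
move=> en minn.
have xn : x <= e n by rewrite leNgt; apply/negP => /minn; rewrite ltnn.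
exists n; case: (branch_endsE n) => -[E0 E1].
- have [|w] := @comp_word_interval [:: n] 0 1 x in01_0 in01_1; last by exists w.
  by rewrite /= E0 E1 ltW.
- have [|w] := @comp_word_interval [:: n] 1 0 x in01_1 in01_0; last by exists w.
  by rewrite /= E0 E1 ltW.
Qed.

Lemma branch_interior_inj i j x y : x \in `]0, 1[ -> y \in `]0, 1[ ->
  f i x = f j y -> i = j.
Proof.
move=> x01 y01 fxy; have := branch_interior i x01; have := branch_interior j y01.
rewrite -fxy; case: (ltngtP i j) => // /upper_end_le h /andP[? ?] /andP[? ?]; exfalso; lra.
Qed.

Lemma comp_word_interior_inj u v x y : x \in `]0, 1[ -> y \in `]0, 1[ ->
  size u = size v -> F u x = F v y -> u = v.
Proof.
move=> x01 y01; elim: u v => [|i u IH] [|j v]//= [] uv fxy.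
have u01 := comp_word_interior u x01; have v01 := comp_word_interior v y01.
have E := branch_interior_inj u01 v01 fxy; rewrite E.
congr cons; apply: IH => //; move: fxy; rewrite /= E => /strictly_monotone01_inj; apply.
- exact: branch_strictly_monotone.
- by move: u01; rewrite !in_itv/=; lra.
- by move: v01; rewrite !in_itv/=; lra.
Qed.

(* Ending in the second letter places a cylinder in the interior of its parent. *)
Lemma disjoint_interior_cylinders u v x y : x \in `[0, 1] -> y \in `[0, 1] ->
  size u = size v -> F (rcons u 1%N) x = F (rcons v 1%N) y -> u = v.
Proof.
have f101 z : z \in `[0, 1] -> f 1%N z \in `]0, 1[.
  move=> /(branch_range 1); rewrite in_itv/=.
  by have := upper_end_gt0 2; have := upper_endS_lt 0; rewrite upper_end0; lra.
move=> /f101 x01 /f101 y01 uv; rewrite -!cats1 !comp_word_cat.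
exact: comp_word_interior_inj.
Qed.

(** Consecutive children abut: child [i] is the image under [F u] of the interval from [e i.+1] to
    [e i], so the sum telescopes from [e 0 = 1] down to [e N]. *)
Lemma sum_len_rcons N u :
  \sum_(i < N) len (rcons u i) = `|F u 1 - F u (e N)|.
Proof.
elim: N => [|N IH]; first by rewrite big_ord0 upper_end0 subrr normr0.
have e1 : e N <= 1 by have := upper_end01 N; rewrite in01 => /andP[].
rewrite big_ord_recr/= IH.
rewrite (strictly_monotone01_dist (comp_word_strictly_monotone u)
  (ltW (upper_end_gt0 N.+1)) (ltW (upper_endS_lt N)) e1 (lexx 1)).
congr (_ + _); rewrite /cylinder_length -cats1 !comp_word_cat /=.
by case: (branch_endsE N) => -[-> ->]//; rewrite distrC.
Qed.

Lemma sum_len_rcons_le N u : \sum_(i < N) len (rcons u i) <= len u.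
Proof. by rewrite sum_len_rcons; apply: comp_word_dist_le; rewrite ?in01_1 ?upper_end01. Qed.

Lemma len_sub_sum N u :
  len u - \sum_(i < N) len (rcons u i) = `|F u (e N) - F u 0|.
Proof.
rewrite sum_len_rcons /cylinder_length.
have := upper_end01 N; rewrite in01 => /andP[e0 e1].
by rewrite (strictly_monotone01_dist (comp_word_strictly_monotone u) (lexx 0) e0 e1) // addrAC subrr add0r.
Qed.

Lemma is_derive_comp_word u x : x \in `]0, 1[ -> exists l, is_derive x 1 (F u) l.
Proof.
move=> x01; elim: u => [|i u [l IH]]; first by exists 1; exact: is_derive_id.
have u01 := comp_word_interior u x01.
have fd : is_derive (F u x) 1 (f i) (deriv01 (f i) (F u x)).
  apply/(has_deriv01_is_derive _ _ u01)/C1_01_has_deriv; first exact: branch_C1 Hf i.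
  by move: u01; rewrite !in_itv/=; lra.
by exists (deriv01 (f i) (F u x) * l); apply: is_derive1_comp.
Qed.

Lemma comp_word_MVT u x y : 0 <= x -> x < y -> y <= 1 ->
  exists2 z, z \in `]0, 1[ & F u y - F u x = deriv01 (F u) z * (y - x).
Proof.
move=> x0 xy y1; have in01' z : z \in `]x, y[ -> z \in `]0, 1[.
  by rewrite !in_itv/=; lra.
have [||z zxy E] := @MVT R (F u) (deriv01 (F u)) x y xy.
- move=> z /in01' z01; have [l ld] := is_derive_comp_word u z01.
  by rewrite (deriv01_is_derive z01 ld).
- apply: continuous_subspaceW (comp_word_continuous (u := u)).
  by move=> z /=; rewrite !in_itv/= => /andP[? ?]; lra.
by exists z => //; exact: in01'.
Qed.

(** Contraction is only given for [m] branches at a time, so a word is cut into [size u %/ m] blocks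
    of length [m]; the leftover letters merely map [[0, 1]] into itself. *)
Lemma len_vanishing : exists2 eps : nat -> R, eps n @[n --> \oo] --> 0 &
  forall u, len u <= eps (size u).
Proof.
have [m [xi [m0 xi1 H]]] := branch_contraction Hf.
have xi0 : 0 <= xi.
  apply: le_trans (H (nseq_tuple m 0%N) (1 / 2) _) => //.
  by rewrite in_itv/=; lra.
have contr u x y : size u = m -> x \in `[0, 1] -> y \in `[0, 1] ->
    `|F u x - F u y| <= xi * `|x - y|.
  move=> um; wlog xy : x y / y < x.
    move=> W x01 y01; case: (ltgtP x y) => [xy|xy|->]; last by rewrite !subrr normr0 mulr0.
    - by rewrite distrC (distrC x); apply: W.
    - exact: W.
  rewrite !in01 => /andP[x0 x1] /andP[y0 y1].
  have [z z01 ->] := comp_word_MVT u y0 xy x1.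
  rewrite normrM ler_wpM2r//; move/eqP: um => um; exact: H (Tuple um) z z01.
have pow k u x y : (k * m <= size u)%N -> x \in `[0, 1] -> y \in `[0, 1] ->
    `|F u x - F u y| <= xi ^+ k.
  elim: k u => [|k IH] u ku x01 y01.
    have := comp_word01 u x01; have := comp_word01 u y01.
    by rewrite expr0 !in01 ler_norml; lra.
  have mu : (m <= size u)%N by rewrite (leq_trans _ ku)// mulSn leq_addr.
  rewrite -(cat_take_drop m u) !comp_word_cat.
  apply: (le_trans (contr _ _ _ _ (comp_word01 _ x01) (comp_word01 _ y01))).
    by rewrite size_takel.
  rewrite exprS ler_wpM2l// IH// size_drop.
  by rewrite leq_subRL // -mulSn.
exists (fun n => xi ^+ (n %/ m)); last first.
  by move=> u; apply: pow; rewrite ?in01_0 ?in01_1 ?leq_divM.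
apply/cvgrPdist_lt => d d0.
have /cvgrPdist_lt/(_ _ d0)[N _ HN] : xi ^+ n @[n --> \oo] --> (0 : R).
  by apply: cvg_expr; rewrite ger0_norm.
exists (N * m)%N => //= n /= Nn; apply: HN; rewrite /= leq_divRL//.
Qed.

End Cylinders.

(** * Codings and bounded distortion *)

Fixpoint prepend (u : seq nat) (w : nat -> nat) : nat -> nat :=
  if u is i :: v then (fun n => if n is m.+1 then prepend v w m else i) else w.

Lemma mkseq_prepend u w : mkseq (prepend u w) (size u) = u.
Proof. by elim: u => //= i u IH; rewrite /mkseq /= -[in RHS]IH (iotaDl 1 0) -map_comp. Qed.

Lemma mkseqS_shift w n : mkseq w n.+1 = w 0%N :: mkseq (shift_seq w) n.
Proof. by rewrite /mkseq /= (iotaDl 1 0) -map_comp. Qed.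

Lemma mkseqD (w : nat -> nat) m n :
  mkseq w (m + n) = mkseq w m ++ mkseq (fun i => w (m + i)%N) n.
Proof. by rewrite /mkseq iotaD map_cat add0n -{2}(addn0 m) iotaDl -map_comp. Qed.

Section Coding.
Context {R : realType} {o : orientation} {T : R -> R} {f : nat -> R -> R}.
Hypothesis Hf : countable_markov_map o T f.
Implicit Types (u v : seq nat) (x y : R) (w : nat -> nat).

Local Notation F := (comp_word f).
Local Notation len := (cylinder_length f).

Lemma len_small d : 0 < d -> exists N, forall u, (N <= size u)%N -> len u < d.
Proof.
move=> d0; have [eps /cvgrPdist_lt/(_ _ d0)[N _ HN] le] := len_vanishing Hf.
exists N => u /HN; rewrite /= sub0r normrN => h.
by rewrite (le_lt_trans (le u))// (le_lt_trans _ h)// ler_norm.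
Qed.

Lemma coding_cvg w : F (mkseq w n) 0 @[n --> \oo] --> coding f w.
Proof.
suff : cvg (F (mkseq w n) 0 @[n --> \oo]) by [].
apply/cauchy_cvgP/cauchy_exP => d d0; have [N HN] := len_small d0.
exists (F (mkseq w N) 0); exists N => // n /= Nn.
rewrite /ball /= -(subnKC Nn) mkseqD comp_word_cat.
apply: le_lt_trans (HN (mkseq w N) _); last by rewrite size_mkseq.
by apply: (comp_word_dist_le Hf); rewrite ?in01_0//; apply: comp_word01 Hf _ _ in01_0.
Qed.

Lemma coding_unique w l : (F (mkseq w n) 0 @[n --> \oo] --> l) -> coding f w = l.
Proof. exact: cvg_lim. Qed.

Lemma coding01 w : coding f w \in `[0, 1].
Proof.
have c := @coding_cvg w; have h n := comp_word01 Hf (mkseq w n) in01_0.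
rewrite in01; apply/andP; split.
- by apply: (limr_ge (cvgP _ c)); near=> n; have := h n; rewrite in01 => /andP[].
- by apply: (limr_le (cvgP _ c)); near=> n; have := h n; rewrite in01 => /andP[].
Unshelve. all: by end_near. Qed.

Lemma coding_shift w : coding f w = f (w 0%N) (coding f (shift_seq w)).
Proof.
apply: coding_unique; rewrite -(cvg_shiftS (fun n => F (mkseq w n) 0)).
apply/cvgrPdist_lt => d d0.
have /continuous01P fc := C1_01_continuous (branch_C1 Hf (w 0%N)).
have [d1 d10 H1] := fc _ (coding01 (shift_seq w)) _ d0.
have /cvgrPdist_lt/(_ _ d10)[N _ HN] := @coding_cvg (shift_seq w).
exists N => // n /= Nn.
suff : `|f (w 0%N) (coding f (shift_seq w)) - F (mkseq w n.+1) 0| < d by [].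
rewrite mkseqS_shift /= distrC; apply: H1.
- exact: comp_word01 Hf _ _ in01_0.
- by rewrite distrC; apply: HN.
Qed.

Lemma coding_prepend u w : coding f (prepend u w) = F u (coding f w).
Proof. by elim: u => //= i u IH; rewrite coding_shift /= -IH. Qed.

Lemma coding_mkseq w n :
  coding f w = F (mkseq w n) (coding f (fun m => w (n + m)%N)).
Proof.
elim: n w => [|n IH] w //.
by rewrite coding_shift (IH (shift_seq w)) mkseqS_shift.
Qed.

Lemma exists_coding x : x \in `[0, 1] -> (forall u, x <> F u 0) ->
  exists w, forall n, exists2 y, y \in `[0, 1] & x = F (mkseq w n) y.
Proof.
move=> x01 xF.
have [g Hg] : {g : R -> nat * R & forall t, 0 < t -> t <= 1 ->
    (g t).2 \in `[0, 1] /\ f (g t).1 (g t).2 = t}.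
  apply: (@choice R (nat * R) (fun t p => 0 < t -> t <= 1 -> p.2 \in `[0, 1] /\ f p.1 p.2 = t)).
  move=> t; have [t0|t0] := ltP 0 t; last by exists (0%N, 0).
  have [t1|t1] := leP t 1; last by exists (0%N, 0).
  by have [i [y [y01 fy]]] := branch_cover Hf t0 t1; exists (i, y).
pose t n := iter n (fun t => (g t).2) x; pose w n := (g (t n)).1.
have Ht n : t n \in `[0, 1] /\ x = F (mkseq w n) (t n).
  elim: n => [//|n [tn01 IH]].
  (* 0 is the only point of [[0, 1]] in no branch interval, and an orbit that reaches it would
     exhibit [x] as some [F u 0]. *)
  have tn0 : 0 < t n.
    move: tn01; rewrite in01 le_eqVlt => /andP[/predU1P[t0|//] _].
    by exfalso; apply: (xF (mkseq w n)); rewrite {1}IH -t0.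
  move: (tn01); rewrite in01 => /andP[_ tn1].
  have [tS fS] := Hg _ tn0 tn1; split=> //.
  have -> : F (mkseq w n.+1) (t n.+1) = F (mkseq w n) (f (w n) (t n.+1)).
    by rewrite -addn1 mkseqD comp_word_cat /= addn0.
  by rewrite [f _ _]fS.
by exists w => n; exists (t n); case: (Ht n).
Qed.

Lemma coding_dense x d : x \in `[0, 1] -> 0 < d ->
  exists w, `|coding f w - x| < d.
Proof.
move=> x01 d0.
have approx n : forall x d, x \in `[0, 1] -> 0 < d ->
    exists u y, [/\ size u = n, y \in `[0, 1] & `|F u y - x| < d].
  elim: n => [|n IH] {}x {}d {}x01 {}d0.
    by exists [::], x; rewrite /= subrr normr0.
  have [i [y [y01 fy]]] : exists i y, y \in `[0, 1] /\ `|f i y - x| < d.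
    move: (x01); rewrite in01 le_eqVlt => /andP[/predU1P[<-|x0] x1].
      (* The point 0 lies in no branch interval, but the ends of far branch intervals approach
         it. *)
      have /cvgrPdist_lt/(_ _ d0)[N _ HN] := upper_end_cvg Hf.
      have := HN N (leqnn N); rewrite /= sub0r normrN => h.
      have E : f N 0 = upper_end f N \/ f N 1 = upper_end f N.
        by case: (branch_endsE Hf N) => -[? ?]; [right|left].
      by case: E => E; [exists N, 0|exists N, 1];
        rewrite ?in01_0 ?in01_1 E subr0.
    have [i [y [y01 fy]]] := branch_cover Hf x0 x1.
    by exists i, y; rewrite fy subrr normr0.
  have e0 : 0 < d - `|f i y - x| by rewrite subr_gt0.
  have /continuous01P fc := C1_01_continuous (branch_C1 Hf i).
  have [d1 d10 H1] := fc _ y01 _ e0.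
  have [u [z [un z01 uz]]] := IH y d1 y01 d10.
  exists (i :: u), z; split=> //=; first by rewrite un.
  have {}H1 := H1 _ (comp_word01 Hf u z01) uz.
  have := ler_normD (f i (F u z) - f i y) (f i y - x); rewrite subrKA; lra.
(* Every coded point of a short cylinder that passes near [x] will do; the tail of zeros is an
   arbitrary choice. *)
have d20 : 0 < d / 2 by rewrite divr_gt0.
have [N HN] := len_small d20; have [u [y [un y01 uy]]] := approx N x _ x01 d20.
exists (prepend u (fun=> 0%N)); rewrite coding_prepend.
have := comp_word_dist_le Hf u (coding01 (fun=> 0%N)) y01.
have := HN u; rewrite un leqnn => /(_ isT) h1 h2.
have := ler_normD (F u (coding f (fun=> 0%N)) - F u y) (F u y - x); rewrite subrKA; lra.
Qed.

End Coding.

Section Distortion.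
Context {R : realType} {o : orientation} {T : R -> R} {f : nat -> R -> R}.
Hypothesis Hf : countable_markov_map o T f.
Hypothesis finf : finite_potential f.
Variable V : R.
Hypothesis sumV : (sum_variations (potential f) <= V%:E)%E.
Implicit Types (u v : seq nat) (x y : R) (w : nat -> nat).

Local Notation F := (comp_word f).
Local Notation len := (cylinder_length f).

(** Indices are shifted: [s n] belongs to cylinders of length [n.+1], since the sum of variations
    starts at 1. The bound on the sum makes every single variation finite, which allows real
    values. *)
Lemma variations_bound : exists s : nat -> R,
  (forall n, \sum_(i < n) s i <= V) /\
  forall n u w w', size u = n.+1 -> cylinder u w -> cylinder u w' ->
    `|potential f w - potential f w'| <= s n.
Proof.
have var_ge0 n : (0 <= var_n n (potential f))%E.
  apply: (@le_trans _ _ (ereal_sup [set `|potential f jk.1 - potential f jk.2|%:E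
    | jk in cylinder (nseq n 0%N) `*` cylinder (nseq n 0%N)])).
    apply: ereal_sup_ubound; exists (prepend (nseq n 0%N) (fun=> 0%N), prepend (nseq n 0%N) (fun=> 0%N)) => /=.
      by split; rewrite /cylinder /= mkseq_prepend.
    by rewrite subrr normr0.
  by apply: ereal_sup_ubound; exists (nseq_tuple n 0%N).
have psum n : (\sum_(1 <= i < n) var_n i (potential f) <= V%:E)%E.
  by apply: le_trans sumV; apply: nneseries_lim_ge.
have fin n : var_n n.+1 (potential f) \is a fin_num.
  rewrite ge0_fin_numE//; apply: le_lt_trans (ltry V); apply: le_trans (psum n.+2).
  by rewrite big_nat_recr//= leeDr// sume_ge0.
exists (fun n => fine (var_n n.+1 (potential f))); split.
- move=> n; rewrite -lee_fin -sumEFin (le_trans _ (psum n.+1))//.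
  rewrite (big_addn 0 n.+1 1) subn1 big_mkord.
  by apply: lee_sum => i _; rewrite fineK ?addn1.
- move=> n u w w' un uw uw'; rewrite -lee_fin fineK//.
  apply: le_trans (ereal_sup_ubound _); last first.
    by exists (tcast un (in_tuple u)).
  apply: ereal_sup_ubound; exists (w, w') => //=.
  by rewrite val_tcast.
Qed.

(** On sequences starting with [i :: v] the potential is the logarithm of the derivative of [f i],
    in absolute value, at a point [F v (coding f w)]. This settles coded points; density is then
    applied in each variable separately. *)
Lemma deriv01_comp_le i v (s : R) :
  (forall w w', cylinder (i :: v) w -> cylinder (i :: v) w' ->
    `|potential f w - potential f w'| <= s) ->
  forall x y, x \in `[0, 1] -> y \in `[0, 1] ->
  `|deriv01 (f i) (F v x)| <= expR s * `|deriv01 (f i) (F v y)|.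
Proof.
move=> Hs; pose G : R -> R := fun x => `|deriv01 (f i) (F v x)|.
have Gc : {within `[0, 1], continuous G}.
  apply/continuous01P => x x01 d d0.
  have [_ /continuous01P fc] := branch_C1 Hf i.
  have [d1 d10 H1] := fc _ (comp_word01 Hf v x01) _ d0.
  have [d2 d20 H2] := (continuous01P _).1 (comp_word_continuous Hf (u := v)) x x01 _ d10.
  exists d2 => // y y01 yd; rewrite (le_lt_trans (ler_dist_dist _ _))//.
  by apply: H1; [exact: (comp_word01 Hf)|exact: H2].
have codingG w w' : G (coding f w) <= expR s * G (coding f w').
  have pot w1 : potential f (prepend (i :: v) w1) = ln (G (coding f w1)).
    by rewrite /potential /G -(coding_prepend Hf).
  have pos w1 : 0 < G (coding f w1).
    rewrite normr_gt0; have := finf (prepend (i :: v) w1).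
    by rewrite /= -(coding_prepend Hf).
  have cyl w1 : cylinder (i :: v) (prepend (i :: v) w1) by exact: mkseq_prepend.
  have := Hs _ _ (cyl w) (cyl w'); rewrite !pot => /(le_trans (ler_norm _)).
  by rewrite lerBlDr -(ler_expR (ln _)) expRD !lnK ?posrE.
have D x d : x \in `[0, 1] -> 0 < d -> exists y,
    [/\ range (coding f) y, y \in `[0, 1] & `|y - x| < d].
  move=> x01 d0; have [w wd] := coding_dense Hf x01 d0.
  by exists (coding f w); split=> //; exact: (coding01 Hf).
have cc c : {within `[0, 1], continuous (fun _ : R => c : R)}.
  by apply/continuous01P => ? _ d d0; exists d => // ? _ _; rewrite subrr normr0.
have Gc' : {within `[0, 1], continuous (fun x => expR s * G x)}.
  apply/continuous01P => x x01 d d0.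
  have d0' : 0 < d / expR s by rewrite divr_gt0// expR_gt0.
  have [d1 d10 H1] := (continuous01P _).1 Gc x x01 _ d0'.
  exists d1 => // y y01 /(H1 y y01); rewrite -mulrBr normrM gtr0_norm ?expR_gt0//.
  by rewrite ltr_pdivlMr ?expR_gt0// mulrC.
move=> x y x01 y01.
apply: (continuous01_le_dense Gc (cc (expR s * G y)) D) x01 => _ [w _ <-] _.
by apply: (continuous01_le_dense (cc _) Gc' D) y01 => _ [w' _ <-] _.
Qed.

(** By the mean value theorem [f i] scales each distance by its derivative at some point of the
    cylinder of [v], and these derivatives agree up to [expR s]. Cross-multiplication admits
    coinciding points. *)
Lemma dist_ratio_step i v (s : R) :
  (forall w w', cylinder (i :: v) w -> cylinder (i :: v) w' ->
    `|potential f w - potential f w'| <= s) ->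
  forall x y x' y', x \in `[0, 1] -> y \in `[0, 1] -> x' \in `[0, 1] -> y' \in `[0, 1] ->
  `|f i (F v x) - f i (F v y)| * `|F v x' - F v y'| <=
  expR s * (`|f i (F v x') - f i (F v y')| * `|F v x - F v y|).
Proof.
move=> Hs.
have mvt x y : x \in `[0, 1] -> y \in `[0, 1] ->
    exists2 z, z \in `[0, 1] &
    `|f i (F v x) - f i (F v y)| = `|deriv01 (f i) (F v z)| * `|F v x - F v y|.
  wlog xy : x y / F v y <= F v x.
    move=> W x01 y01; case: (leP (F v y) (F v x)) => [/W|/ltW /W]; first exact.
    by move=> /(_ y01 x01); rewrite distrC (distrC (F v y)).
  move=> x01 y01; move: xy; rewrite le_eqVlt => /predU1P[->|xy].
    by exists x => //; rewrite !subrr normr0 mulr0.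
  have := comp_word01 Hf v x01; have := comp_word01 Hf v y01.
  rewrite !in01 => /andP[a0 _] /andP[_ b1].
  have [z /andP[yz zx] ->] := C1_01_MVT (branch_C1 Hf i) a0 xy b1.
  have [|z' z'01 E] := @comp_word_interval _ _ _ _ Hf v y x z y01 x01.
    by rewrite !ltW.
  by exists z' => //; rewrite E normrM.
move=> x y x' y' x01 y01 x'01 y'01.
have [z z01 ->] := mvt x y x01 y01; have [z' z'01 ->] := mvt x' y' x'01 y'01.
have h := deriv01_comp_le Hs z01 z'01.
have -> : expR s * (`|deriv01 (f i) (F v z')| * `|F v x' - F v y'| * `|F v x - F v y|) =
  (expR s * `|deriv01 (f i) (F v z')|) * `|F v x - F v y| * `|F v x' - F v y'| by ring.
by rewrite ler_wpM2r// ler_wpM2r.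
Qed.

Lemma dist_ratio u x y x' y' :
  x \in `[0, 1] -> y \in `[0, 1] -> x' \in `[0, 1] -> y' \in `[0, 1] ->
  `|F u x - F u y| * `|x' - y'| <= expR V * (`|F u x' - F u y'| * `|x - y|).
Proof.
have [s [sV Hs]] := variations_bound.
move=> x01 y01 x'01 y'01.
(* A letter followed by [n] others contributes [s n]. Different positions use different terms, so
   the total stays below [V] for words of any length. *)
apply: (@le_trans _ _ (expR (\sum_(i < size u) s i) * (`|F u x' - F u y'| * `|x - y|))); last first.
  by rewrite ler_wpM2r ?mulr_ge0// ler_expR.
elim: u => [|i u IH]; first by rewrite big_ord0 expR0 mul1r /= mulrC.
have [->|xy] := eqVneq x y; first by rewrite !subrr normr0 !(mulr0, mul0r).
have [->|xy'] := eqVneq x' y'; first by rewrite !subrr normr0 !(mulr0, mul0r).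
rewrite /= big_ord_recr /= expRD.
have step := @dist_ratio_step i u _ (fun w w' => Hs (size u) (i :: u) w w' erefl) _ _ _ _ x01 y01 x'01 y'01.
have Fpos a b : a \in `[0, 1] -> b \in `[0, 1] -> a != b -> 0 < `|F u a - F u b|.
  move=> a01 b01 ab; rewrite normr_gt0 subr_eq0; apply: contra ab => /eqP.
  by move=> /(comp_word_inj Hf a01 b01) ->.
have p1 := Fpos _ _ x01 y01 xy; have p2 := Fpos _ _ x'01 y'01 xy'.
rewrite -(ler_pM2r (mulr_gt0 p1 p2)).
have := ler_pM (mulr_ge0 _ _) (mulr_ge0 _ _) step IH.
rewrite !normr_ge0 => /(_ isT isT isT isT) h.
move: h; congr (_ <= _); ring.
Qed.

Lemma len_cat_le u v : len (u ++ v) <= expR V * (len u * len v).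
Proof.
have := dist_ratio u (comp_word01 Hf v in01_1) (comp_word01 Hf v in01_0) in01_1 in01_0.
by rewrite subr0 normr1 mulr1 -!comp_word_cat.
Qed.

Lemma len_cat_ge u v : len u * len v <= expR V * len (u ++ v).
Proof.
have := dist_ratio u in01_1 in01_0 (comp_word01 Hf v in01_1) (comp_word01 Hf v in01_0).
by rewrite subr0 normr1 mulr1 -!comp_word_cat.
Qed.

End Distortion.

(** * Hausdorff dimension *)

Section Hausdorff.
Context {R : realType}.
Implicit Types (E A : set R) (s d : R).
Local Notation mu := (@lebesgue_measure R).

Lemma lebesgue_measureU_le (A B : set R) (a b : \bar R) : measurable A -> measurable B ->
  (mu A <= a)%E -> (mu B <= b)%E -> (mu (A `|` B) <= a + b)%E.
Proof.
move=> mA mB Aa Bb; apply: (@le_trans _ _ (mu A + mu B)%E); last exact: leeD.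
exact: measureU2.
Qed.

Lemma diam_le A d : (forall x y, A x -> A y -> `|x - y| <= d) -> (diam A <= d%:E)%E.
Proof. by move=> H; apply: ge_ereal_sup => _ [[x y] [/= Ax Ay] <-]; rewrite lee_fin H. Qed.

Lemma dist_le_diam A x y : A x -> A y -> (`|x - y|%:E <= diam A)%E.
Proof. by move=> Ax Ay; apply: ereal_sup_ubound; exists (x, y). Qed.

Lemma diam_set0 : diam (set0 : set R) = -oo%E.
Proof.
rewrite /diam (_ : [set _ | _ in _] = set0) ?ereal_sup0//.
by rewrite -subset0 => z [[x y] [/= ]].
Qed.

Lemma diam_pow_set0 s : diam_pow s (set0 : set R) = 0%E.
Proof. by rewrite /diam_pow asboolT. Qed.

Lemma diam_pow_ge0 s A : (0 <= diam_pow s A)%E.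
Proof. by rewrite /diam_pow; case: ifP => // _; exact: poweR_ge0. Qed.

Lemma hausdorff_content_ge0 s d E : (0 <= hausdorff_content s d E)%E.
Proof.
apply: le_ereal_inf_tmp => _ [U _ <-]; apply: nneseries_ge0 => *; exact: diam_pow_ge0.
Qed.

(** The cover consists of [N] intervals of length [1 / N], each contributing [N] to the power
    [- s]. *)
Lemma hausdorff_content_grid s d E N : 1 < s -> E `<=` `[0, 1] ->
  (0 < N)%N -> N%:R^-1 <= d ->
  (hausdorff_content s d E <= (N%:R `^ (1 - s))%:E)%E.
Proof.
move=> s1 E01 N0 Nd.
have NR0 : (0 : R) < N%:R by rewrite ltr0n.
pose U i : set R := if (i < N)%N then `[i%:R / N%:R, i.+1%:R / N%:R]%classic else set0.
have diamU i : (i < N)%N -> (diam (U i) <= (N%:R^-1)%:E)%E.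
  rewrite /U => ->; apply: diam_le => x y; rewrite /= !in_itv /=.
  rewrite -addn1 natrD mulrDl mul1r => /andP[? ?] /andP[? ?].
  by rewrite ler_norml; lra.
apply: le_trans (ereal_inf_lbound _) _.
  exists U; last reflexivity; split=> [i|x /E01].
    have [iN|iN] := ltnP i N.
      by rewrite (le_trans (diamU i iN))// lee_fin.
    by rewrite /U ltnNge iN/= diam_set0 leNye.
  rewrite /= in_itv/= => /andP[x0]; rewrite le_eqVlt => /predU1P[->|x1].
    exists N.-1 => //; rewrite /U prednK// leqnn /= in_itv/= divff ?gt_eqF// lexx andbT.
    by rewrite ler_pdivrMr// mul1r ler_nat leq_pred.
  have xN : 0 <= x * N%:R by rewrite mulr_ge0// ltW.
  exists (Num.trunc (x * N%:R)) => //.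
  have /andP[t1 t2] := Num.Theory.truncn_itv xN.
  have tN : (Num.trunc (x * N%:R) < N)%N.
    by rewrite -(ltr_nat R) (le_lt_trans t1)// -{2}(mul1r N%:R) ltr_pM2r.
  by rewrite /U tN /= in_itv/= ler_pdivrMr// t1 ler_pdivlMr// ltW.
have powU i : (diam_pow s (U i) <= if (i < N)%N then (N%:R `^ (- s))%:E else 0)%E.
  case: ifP => iN; last by rewrite /U iN diam_pow_set0.
  have := diamU i iN.
  rewrite /diam_pow; case: asboolP => [_ _|/eqP /set0P[x Ux] dU].
    by rewrite lee_fin powR_ge0.
  have d0 : (0 <= diam (U i))%E by have := dist_le_diam Ux Ux; rewrite subrr normr0.
  have dfin : diam (U i) \is a fin_num by rewrite ge0_fin_numE// (le_lt_trans dU) ?ltry.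
  move: dU d0; rewrite -(fineK dfin) poweR_EFin !lee_fin => dU d0.
  rewrite powRN -powR_inv1 ?powR_ge0// -powRrM mulrN1.
  have -> : N%:R `^ (- s) = (N%:R^-1) `^ s :> R.
    by rewrite -powR_inv1 ?ltW// -powRrM mulN1r.
  by apply: ge0_ler_powR; rewrite ?nnegrE ?invr_ge0//; lra.
apply: lime_le; first by apply: is_cvg_nneseries => *; exact: diam_pow_ge0.
near=> n.
have Nn : (N <= n)%N by near: n; exists N.
apply: (@le_trans _ _ (\sum_(0 <= i < n) if (i < N)%N then (N%:R `^ (- s))%:E else 0)%E).
  by apply: lee_sum => i _; exact: powU.
rewrite -big_mkcond /= -(big_nat_widen 0 N n xpredT (fun=> (N%:R `^ (- s))%:E) Nn).
rewrite sumEFin big_const_nat subn0 iter_addr addr0.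
have -> : N%:R `^ (1 - s) = N%:R * N%:R `^ (- s) :> R.
  by rewrite powRD ?powRr1 ?ler0n// pnatr_eq0 -lt0n N0 implybT.
by rewrite mulr_natl.
Unshelve. all: by end_near. Qed.

Lemma hausdorff_dim_le1 E : E `<=` `[0, 1] -> (hausdorff_dim E <= 1)%E.
Proof.
move=> E01; apply/lee_addgt0Pr => e e0; apply: ereal_inf_lbound.
exists (1 + e) => //; split; first by rewrite addr_ge0// ltW.
apply/le_anti/andP; split; last first.
  apply: le_trans (ereal_sup_ubound _); last by exists 1 => //=.
  exact: hausdorff_content_ge0.
apply: ge_ereal_sup => _ [d /= d0 <-]; apply/lee_addgt0Pr => h h0; rewrite add0e.
(* The first summand makes the mesh at most [d]; the second makes the bound for the grid, [N] to the
   power [- e], at most [h]. *)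
pose N := (Num.bound (d^-1) + Num.bound (h^-1 `^ e^-1)).+1.
have N1 : d^-1 <= N%:R.
  apply: (@le_trans _ _ (Num.bound d^-1)%:R).
    by rewrite ltW// archi_boundP// invr_ge0 ltW.
  by rewrite ler_nat leqW// leq_addr.
have N2 : h^-1 `^ e^-1 <= N%:R.
  apply: (@le_trans _ _ (Num.bound (h^-1 `^ e^-1))%:R).
    by rewrite ltW// archi_boundP// powR_ge0.
  by rewrite ler_nat leqW// leq_addl.
have s1 : 1 < 1 + e by rewrite ltrDl.
apply: le_trans (hausdorff_content_grid s1 E01 (ltn0Sn _ : (0 < N)%N) _) _.
  by rewrite -/N invf_ple ?posrE// ltr0n.
rewrite -/N lee_fin opprD addNKr powRN invf_ple ?posrE ?powR_gt0 ?ltr0n//.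
have -> : h^-1 = (h^-1 `^ e^-1) `^ e by rewrite -powRrM mulVf ?gt_eqF// powRr1// invr_ge0 ltW.
by apply: ge0_ler_powR; rewrite ?nnegrE ?powR_ge0 ?ler0n// ltW.
Qed.

(* Mass distribution principle for the image under [p] of Lebesgue measure on
   the complement of [Z] in [0, 1]. *)
Lemma hausdorff_dim_ge s (K : R) E (Z : set R) (p : R -> R) :
  0 < s -> 0 <= K -> measurable Z -> (mu Z <= 2^-1%:E)%E ->
  (forall y, 0 <= y <= 1 -> ~ Z y -> E (p y)) ->
  (forall a d, 0 <= d -> exists W : set R, [/\ measurable W, (mu W <= (K * d `^ s)%:E)%E &
     forall y, 0 <= y <= 1 -> ~ Z y -> a <= p y <= a + d -> W y]) ->
  (s%:E <= hausdorff_dim E)%E.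
Proof.
move=> s0 K0 mZ muZ EZ cover.
apply: le_ereal_inf_tmp => _ [r [r0 Hr] <-]; rewrite lee_fin leNgt; apply/negP => rs.
(* [K * k < 1 / 4], so the sets that cover the parameters outside [Z] have, together with [Z], total
   measure below 1. Covers of scale 1 suffice, and diameters at most 1 allow the exponent [s] to be
   lowered to [r]. *)
pose k := (4 * (K + 1))^-1.
have k0 : 0 < k by rewrite invr_gt0 mulr_gt0// ltr_wpDl.
have : (hausdorff_content r 1 E < k%:E)%E.
  apply: (@le_lt_trans _ _ 0%E); last by rewrite lte_fin.
  by rewrite -Hr; apply: ereal_sup_ubound; exists 1 => /=.
move=> /ereal_inf_lt [_ [U [diamU EU] <-] sumU].
have small i : exists W : set R, [/\ measurable W, (mu W <= K%:E * diam_pow r (U i))%E &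
    forall y, 0 <= y <= 1 -> ~ Z y -> U i (p y) -> W y].
  have [U0|/set0P[x0 Ux0]] := eqVneq (U i) set0.
    by exists set0; split=> //; rewrite ?measure0 ?U0 ?diam_pow_set0 ?mule0.
  have d0 : (0 <= diam (U i))%E by have := dist_le_diam Ux0 Ux0; rewrite subrr normr0.
  have dfin : diam (U i) \is a fin_num.
    by rewrite ge0_fin_numE// (le_lt_trans (diamU i)) ?ltry.
  have := diamU i; move: (d0).
  rewrite /diam_pow asboolF; last by move=> U0; rewrite U0 in Ux0.
  have dU x y : U i x -> U i y -> `|x - y| <= fine (diam (U i)).
    by move=> Ux Uy; rewrite -lee_fin fineK//; exact: dist_le_diam.
  move: dU; rewrite -{2 3 4}(fineK dfin); set d := fine _ => dU.
  rewrite poweR_EFin !lee_fin => {}d0 d1.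
  (* [U i] lies in the interval of length [d] that starts at its infimum. *)
  have [W [mW muW HW]] := cover (inf (U i)) d d0.
  exists W; split=> //; last first.
    move=> y y01 yZ Uy; apply: HW => //; apply/andP; split.
      apply: ge_inf => //; exists (x0 - d) => z Uz.
      by have := dU _ _ Ux0 Uz; rewrite ler_norml; lra.
    rewrite -lerBlDr; apply: lb_le_inf; first by exists x0.
    by move=> z Uz; have := dU _ _ Uy Uz; rewrite ler_norml; lra.
  apply: le_trans muW _; rewrite -EFinM lee_fin ler_wpM2l//.
  move: d0; rewrite le_eqVlt => /predU1P[<-|d0]; first by rewrite powR0 ?gt_eqF ?powR_ge0.
  by apply: ger_powR; rewrite ?d0// ltW.
have [W HW] := choice small.
have mW i : measurable (W i) by case: (HW i).
have mUW : measurable (\bigcup_i W i) by exact: bigcup_measurable.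
have : (mu `[0%R, 1%R] <= mu (Z `|` \bigcup_i W i))%E.
  apply: le_measure; rewrite ?inE//.
    by apply: measurableU => //; exact: bigcup_measurable.
  move=> y /=; rewrite in_itv/= => y01.
  have [Zy|Zy] := pselect (Z y); [by left|right].
  have [i _ Uiy] := EU _ (EZ y y01 Zy).
  by exists i => //; case: (HW i) => _ _; apply.
rewrite lebesgue_measure_itv/= lte_fin ltr01 oppr0 adde0.
apply/negP; rewrite -ltNge.
have : (mu (\bigcup_i W i) <= K%:E * k%:E)%E.
  apply: le_trans (@measure_sigma_subadditive _ _ _ mu _ W mW mUW (fun _ h => h)) _.
  apply: (@le_trans _ _ (\sum_(0 <= i <oo) K%:E * diam_pow r (U i))%E).
    by apply: lee_nneseries => // i _; case: (HW i).
  rewrite nneseriesZl; last by move=> *; exact: diam_pow_ge0.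
  by apply: lee_wpmul2l; rewrite ?lee_fin// ltW.
move=> h; apply: le_lt_trans (lebesgue_measureU_le mZ mUW muZ h) _.
rewrite -EFinM -EFinD lte_fin.
have : K * k < 2^-1.
  rewrite /k ltr_pdivrMr ?mulr_gt0 ?ltr_wpDl//; lra.
lra.
Qed.

End Hausdorff.

(** * Words and the conjugacy *)

Fixpoint word_pow (A : seq (seq nat)) (n : nat) : seq (seq nat) :=
  if n is m.+1 then [seq u ++ v | u <- A, v <- word_pow A m] else [:: [::]].

Definition words (N n : nat) : seq (seq nat) :=
  word_pow [seq [:: i] | i <- iota 0 N] n.

Section Words.
Implicit Types (u v : seq nat) (A : seq (seq nat)).

Lemma size_word_pow A n : size (word_pow A n) = (size A ^ n)%N.
Proof. by elim: n => //= n IH; rewrite size_allpairs IH expnS. Qed.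

Lemma size_in_word_pow A n m v : {in A, forall u, size u = m} ->
  v \in word_pow A n -> size v = (n * m)%N.
Proof.
move=> Am; elim: n v => [|n IH] v /=; first by rewrite inE => /eqP ->.
by move=> /allpairsP[[u w] /= [uA wA ->]]; rewrite size_cat (Am u uA) (IH w wA) mulSn.
Qed.

Lemma uniq_word_pow A n m : {in A, forall u, size u = m} -> uniq A ->
  uniq (word_pow A n).
Proof.
move=> Am uA; elim: n => //= n IH; apply: allpairs_uniq => //.
move=> [u v] [u' v'] /allpairsP[[a b] /= [aA bA [-> ->]]] /allpairsP[[a' b'] /= [aA' bA' [-> ->]]].
by move=> /eqP; rewrite eqseq_cat ?(Am a) ?(Am a')// => /andP[/eqP -> /eqP ->].
Qed.

Lemma mem_words N n v : (v \in words N n) = (size v == n) && all (fun i => i < N)%N v.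
Proof.
rewrite /words; elim: n v => [|n IH] v /=; first by rewrite inE; case: v.
apply/allpairsP/idP => [[[u w] /= [/mapP[i]]]|].
  by rewrite mem_iota => /andP[_ iN] -> wn ->; rewrite /= eqSS iN -IH.
case: v => //= i v; rewrite eqSS => /and3P[vn iN va].
exists ([:: i], v); split=> //=; last by rewrite IH vn.
by apply/mapP; exists i => //; rewrite mem_iota.
Qed.

Lemma uniq_words N n : uniq (words N n).
Proof.
apply: (@uniq_word_pow _ _ 1); last by rewrite map_inj_uniq ?iota_uniq// => i j [].
by move=> u /mapP[i _ ->].
Qed.

Context {R : realType}.
Implicit Types (F : seq nat -> R).

Lemma sum_wordsS N n F :
  \sum_(v <- words N n.+1) F v = \sum_(i < N) \sum_(v <- words N n) F (val i :: v).
Proof.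
rewrite /words /= big_allpairs_dep big_map -(big_mkord xpredT (fun i => \sum_(v <- words N n) F (i :: v))).
by rewrite /index_iota subn0.
Qed.

Lemma sum_wordsD N m n F :
  \sum_(v <- words N (m + n)) F v =
  \sum_(u <- words N m) \sum_(v <- words N n) F (u ++ v).
Proof.
elim: m F => [|m IH] F; first by rewrite [words N 0]/words /= big_seq1.
by rewrite addSn !sum_wordsS; apply: eq_bigr => i _; rewrite IH.
Qed.

Lemma sum_words_rcons N n F :
  \sum_(v <- words N n.+1) F v = \sum_(u <- words N n) \sum_(i < N) F (rcons u i).
Proof.
rewrite -addn1 sum_wordsD; apply: eq_bigr => u _.
rewrite sum_wordsS; apply: eq_bigr => i _.
by rewrite [words N 0]/words /= big_seq1 cats1.
Qed.

Lemma sum_words_prod N n (p : nat -> R) :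
  \sum_(v <- words N n) \prod_(i <- v) p i = (\sum_(i < N) p i) ^+ n.
Proof.
elim: n => [|n IH]; first by rewrite [words N 0]/words /= big_seq1 big_nil.
rewrite sum_wordsS exprS -IH mulr_suml; apply: eq_bigr => i _.
by rewrite mulr_sumr; apply: eq_bigr => v _; rewrite big_cons.
Qed.

Lemma sum_words_restrict M N n F : (M <= N)%N ->
  \sum_(v <- words N n | all (fun i => i < M)%N v) F v = \sum_(v <- words M n) F v.
Proof.
move=> MN; rewrite -big_filter; apply/perm_big/uniq_perm.
- by rewrite filter_uniq// uniq_words.
- exact: uniq_words.
move=> v; rewrite mem_filter !mem_words; case: eqP => //= _; rewrite ?andbF//.
apply/andb_idr => /allP H; apply/allP => i /H /= h; exact: leq_trans h MN.
Qed.

End Words.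

Section CylinderSums.
Context {R : realType} {o : orientation} {T : R -> R} {f : nat -> R -> R}.
Hypothesis Hf : countable_markov_map o T f.
Local Notation len := (cylinder_length f).

Lemma sum_words_len_le N n u : \sum_(v <- words N n) len (u ++ v) <= len u.
Proof.
elim: n => [|n IH]; first by rewrite [words N 0]/words /= big_seq1 cats0.
rewrite sum_words_rcons (le_trans _ IH)//; apply: ler_sum => v _.
under eq_bigr do rewrite -rcons_cat.
exact: (sum_len_rcons_le Hf).
Qed.

Lemma sum_words_len_le1 N n : \sum_(v <- words N n) len v <= 1.
Proof. by have := sum_words_len_le N n [::]; rewrite len_nil. Qed.

End CylinderSums.

Section Conjugacy.
Context {R : realType} {o : orientation}.
Context {S : R -> R} {g : nat -> R -> R} {T : R -> R} {f : nat -> R -> R} {h : R -> R}.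
Hypothesis Hg : countable_markov_map o S g.
Hypothesis Hf : countable_markov_map o T f.
Hypothesis Hh : conjugacy S g T f h.
Implicit Types (u v : seq nat) (x y : R).

Lemma conjugacy01 x : x \in `[0, 1] -> h x \in `[0, 1].
Proof. by case: Hh => -[_ [k [H _ _ _ _]]] _ _ /H[]. Qed.

Lemma conjugacy_lt x y : x \in `[0, 1] -> y \in `[0, 1] -> x < y -> h x < h y.
Proof. by case: Hh => -[hm _] _ _; apply: hm. Qed.

Lemma conjugacy_le x y : x \in `[0, 1] -> y \in `[0, 1] -> x <= y -> h x <= h y.
Proof.
by move=> x01 y01; rewrite le_eqVlt => /predU1P[->//|/(conjugacy_lt x01 y01)/ltW].
Qed.

Lemma conjugacy_surj y : y \in `[0, 1] -> exists2 x, x \in `[0, 1] & h x = y.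
Proof.
case: Hh => -[_ [k [H _ kh _ _]]] _ _ y01.
by exists (k y); [case: (H y y01)|exact: kh].
Qed.

Lemma conjugacy0 : h 0 = 0.
Proof.
have [x x01 hx] := conjugacy_surj in01_0; apply/le_anti/andP; split.
  by rewrite -{2}hx; apply: conjugacy_le => //; [exact: in01_0|move: x01]; rewrite in01 => /andP[].
by have := conjugacy01 in01_0; rewrite in01 => /andP[].
Qed.

Lemma conjugacy1 : h 1 = 1.
Proof.
have [x x01 hx] := conjugacy_surj in01_1; apply/le_anti/andP; split.
  by have := conjugacy01 in01_1; rewrite in01 => /andP[].
by rewrite -{1}hx; apply: conjugacy_le => //; [exact: in01_1|move: x01]; rewrite in01 => /andP[].
Qed.

Lemma continuous01_comp (a b : R -> R) : {in `[0, 1], forall x, b x \in `[0, 1]} ->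
  {within `[0, 1], continuous a} -> {within `[0, 1], continuous b} ->
  {within `[0, 1], continuous (a \o b)}.
Proof.
move=> b01 /continuous01P ac /continuous01P bc; apply/continuous01P => x x01 d d0.
have [d1 d10 H1] := ac _ (b01 x x01) _ d0; have [d2 d20 H2] := bc x x01 _ d10.
by exists d2 => // y y01 yd; apply: H1; [exact: b01|exact: H2].
Qed.

Lemma conjugacy_comp_word u x : x \in `[0, 1] ->
  h (comp_word g u x) = comp_word f u (h x).
Proof.
have [[_ [k [_ _ _ hc _]]] _ hcod] := Hh.
have c1 : {within `[0, 1], continuous (h \o comp_word g u)}.
  by apply: continuous01_comp hc _; [exact: comp_word01 Hg u|exact: (comp_word_continuous Hg (u := u))].
have c2 : {within `[0, 1], continuous (comp_word f u \o h)}.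
  by apply: continuous01_comp hc; [exact: conjugacy01|exact: (comp_word_continuous Hf (u := u))].
have D y d : y \in `[0, 1] -> 0 < d -> exists z,
    [/\ range (coding g) z, z \in `[0, 1] & `|z - y| < d].
  move=> y01 d0; have [w wd] := coding_dense Hg y01 d0.
  by exists (coding g w); split=> //; exact: (coding01 Hg).
have E w : h (comp_word g u (coding g w)) = comp_word f u (h (coding g w)).
  by rewrite -(coding_prepend Hg) !hcod (coding_prepend Hf).
move=> x01; apply/le_anti/andP; split.
- by apply: (continuous01_le_dense c1 c2 D _ x01) => _ [w _ <-] _ /=; rewrite E.
- by apply: (continuous01_le_dense c2 c1 D _ x01) => _ [w _ <-] _ /=; rewrite E.
Qed.

Lemma conjugacy_len u : cylinder_length f u = `|h (comp_word g u 1) - h (comp_word g u 0)|.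
Proof. by rewrite !conjugacy_comp_word ?in01_0 ?in01_1// conjugacy0 conjugacy1. Qed.

(** A zero derivative bounds the displacement under [h] of both ends of a small cylinder around [x].
    The ends lie on either side of [x], so the two bounds add up to an inequality between the
    lengths of the cylinder and its image. *)
Lemma not_deriv0 x (M : R) : 0 < M -> x \in `[0, 1] ->
  (forall d, 0 < d -> exists u y, [/\ y \in `[0, 1], x = comp_word g u y,
     cylinder_length g u < d & cylinder_length g u <= M * cylinder_length f u]) ->
  ~ has_deriv01 h x 0.
Proof.
move=> M0 x01 H /has_deriv01P D.
(* The factor 2 yields the contradiction: the length for [g] would be at most half of itself. *)
have e0 : 0 < (2 * M)^-1 by rewrite invr_gt0 mulr_gt0.
have [d d0 Hd] := D _ e0; have [u [y [y01 xE lend lenM]]] := H d d0.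
have near z : z \in `[0, 1] -> `|z - x| < d -> `|h z - h x| <= (2 * M)^-1 * `|z - x|.
  move=> z01 zx; have [->|zx0] := eqVneq z x; first by rewrite !subrr normr0 mulr0.
  have := Hd z z01 zx0 zx; rewrite subr0 normrM normfV.
  by rewrite ltr_pdivrMr ?normr_gt0 ?subr_eq0// => /ltW.
have nearu z : z \in `[0, 1] -> `|h (comp_word g u z) - h x| <= (2 * M)^-1 * `|comp_word g u z - x|.
  move=> z01; apply: near; first exact: comp_word01 Hg u _ z01.
  by rewrite {1}xE (le_lt_trans (comp_word_dist_le Hg u z01 y01)).
have := nearu 1 in01_1; have := nearu 0 in01_0 => n0 n1.
have : cylinder_length f u <= (2 * M)^-1 * cylinder_length g u.
  rewrite conjugacy_len (le_trans (ler_distD (h x) _ _))// (distrC (h x)).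
  rewrite (le_trans (lerD n1 n0))// -mulrDr ler_wpM2l ?(ltW e0)//.
  rewrite /cylinder_length; move: (y01); rewrite in01 => /andP[y0 y1].
  rewrite (strictly_monotone01_dist (comp_word_strictly_monotone Hg u) (lexx 0) y0 y1 (lexx 1)).
  by rewrite -xE (distrC x).
rewrite -(ler_pM2l M0) => /(le_trans lenM).
rewrite mulrA invfM mulrCA divff ?gt_eqF// mulr1.
by have := len_gt0 Hg u; lra.
Qed.

End Conjugacy.

Section Perturbation.
Context {R : realType} {o : orientation}.
Context {T : R -> R} {f : nat -> R -> R} {Tk : nat -> R -> R} {fk : nat -> nat -> R -> R}.
Hypothesis Hf : countable_markov_map o T f.
Hypothesis Hk : forall k, countable_markov_map o (Tk k) (fk k).
Hypothesis Hfin : forall k, finite_potential (fk k).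
Variable V : R.
Hypothesis HV : forall k, (sum_variations (potential (fk k)) <= V%:E)%E.
Hypothesis fk_cvg : forall i x, x \in `[0, 1] -> fk k i x @[k --> \oo] --> f i x.

(** Pointwise limits compose only under equicontinuity. Bounded distortion for one-letter words
    supplies it: every branch of every [T_k] has Lipschitz constant [expR V]. *)
Lemma comp_word_cvg u x : x \in `[0, 1] ->
  comp_word (fk k) u x @[k --> \oo] --> comp_word f u x.
Proof.
move=> x01; elim: u => [|i u IH]; first exact: cvg_cst.
have lip k y z : y \in `[0, 1] -> z \in `[0, 1] -> `|fk k i y - fk k i z| <= expR V * `|y - z|.
  move=> y01 z01; have := dist_ratio (Hk k) (Hfin k) (HV k) [:: i] y01 z01 in01_1 in01_0.
  rewrite subr0 normr1 mulr1 => /le_trans; apply.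
  by rewrite ler_wpM2l ?expR_ge0// ler_piMl//; exact: len_le1 (Hk k) [:: i].
have u01 := comp_word01 Hf u x01.
apply/cvgrPdist_lt => d d0.
have d20 : 0 < d / 2 by rewrite divr_gt0.
have d30 : 0 < d / 2 / expR V by rewrite divr_gt0// expR_gt0.
move/cvgrPdist_lt: IH => /(_ _ d30) IH.
have /cvgrPdist_lt/(_ _ d20) H := @fk_cvg i _ u01.
near=> k => /=.
have h1 : `|comp_word f u x - comp_word (fk k) u x| < d / 2 / expR V by near: k.
have h2 : `|f i (comp_word f u x) - fk k i (comp_word f u x)| < d / 2 by near: k.
have h3 := lip k _ _ u01 (comp_word01 (Hk k) u x01).
move: h1; rewrite ltr_pdivlMr ?expR_gt0// mulrC => h1.
have := ler_distD (fk k i (comp_word f u x)) (f i (comp_word f u x)) (fk k i (comp_word (fk k) u x)).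
rewrite /=; lra.
Unshelve. all: by end_near. Qed.

Lemma len_cvg u : cylinder_length (fk k) u @[k --> \oo] --> cylinder_length f u.
Proof.
by apply: cvg_norm; apply: cvgB; apply: comp_word_cvg; rewrite ?in01_0 ?in01_1.
Qed.

(** Finiteness of the list is essential, as the convergence is not uniform in the letters. This is
    the only way in which convergence of the branches enters the dimension estimates. *)
Lemma len_near (A : seq (seq nat)) : \forall k \near \oo, forall u, u \in A ->
  cylinder_length f u / 2 <= cylinder_length (fk k) u <= 2 * cylinder_length f u.
Proof.
elim: A => [|v A IH]; first by near=> k.
have v0 : 0 < cylinder_length f v / 2 by rewrite divr_gt0// (len_gt0 Hf).
have /cvgrPdist_lt/(_ _ v0) H := @len_cvg v.
near=> k; have IHk : forall u, u \in A -> cylinder_length f u / 2 <=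
    cylinder_length (fk k) u <= 2 * cylinder_length f u by near: k.
move=> u; rewrite inE => /predU1P[->|/IHk//].
have : `|cylinder_length f v - cylinder_length (fk k) v| < cylinder_length f v / 2 by near: k.
rewrite ltr_norml; lra.
Unshelve. all: by end_near. Qed.

End Perturbation.

(** * A much shorter letter *)

Definition quasi_multiplicative (R : realType) (C : R) (len : seq nat -> R) : Prop :=
  forall u v, len (u ++ v) <= C * (len u * len v) /\ len u * len v <= C * len (u ++ v).

Lemma powR_exprn (R : realType) (a s : R) n : 0 <= a -> (a ^+ n) `^ s = (a `^ s) ^+ n.
Proof.
by move=> a0; rewrite -powR_mulrn// -powRrM mulrC powRrM powR_mulrn// powR_ge0.
Qed.

(** A cylinder is an interval; if it meets [[a, a + d]] and is longer than [d], it cannot lie inside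
    and so contains an end. Covering an interval thereby reduces to covering the two points [a] and
    [a + d]. *)
Lemma cylinder_meets_end (R : realType) o (T : R -> R) (g : nat -> R -> R) u (a d t : R) :
  countable_markov_map o T g -> t \in `[0, 1] ->
  a <= comp_word g u t <= a + d -> d < cylinder_length g u ->
  exists b y, [/\ b = a \/ b = a + d, y \in `[0, 1] & comp_word g u y = b].
Proof.
move=> Hg t01 /andP[at_ td] dl.
have t0 := comp_word_dist_le Hg u t01 in01_0; have t1 := comp_word_dist_le Hg u t01 in01_1.
wlog [x [y [x01 y01 xt ty xy]]] : / exists x y, [/\ x \in `[0, 1], y \in `[0, 1],
    comp_word g u x <= comp_word g u t, comp_word g u t <= comp_word g u y &
    cylinder_length g u = comp_word g u y - comp_word g u x].
  apply; move: t0 t1; rewrite /cylinder_length.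
  have [l|l] := leP 0 (comp_word g u 1 - comp_word g u 0).
    rewrite (ger0_norm l) !ler_norml => t0 t1; exists 0, 1; split; rewrite ?in01_0 ?in01_1//; lra.
  rewrite (ltr0_norm l) !ler_norml => t0 t1; exists 1, 0; split; rewrite ?in01_0 ?in01_1//; lra.
have [ax|xa] := leP (comp_word g u x) a.
- have [|z z01 zE] := @comp_word_interval _ _ _ _ Hg u x t a x01 t01; first by rewrite ax.
  by exists a, z; split=> //; left.
- have [|z z01 zE] := @comp_word_interval _ _ _ _ Hg u t y (a + d) t01 y01.
    by rewrite td; lra.
  by exists (a + d), z; split=> //; right.
Qed.

(** * Cantor sets coded by sequences of blocks from a finite list *)

Section FiniteSubsystem.
Context {R : realType} {o : orientation}.
Context {S : R -> R} {g : nat -> R -> R} {T : R -> R} {f : nat -> R -> R} {h : R -> R}.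
Hypothesis Hg : countable_markov_map o S g.
Hypothesis Hf : countable_markov_map o T f.
Hypothesis Hh : conjugacy S g T f h.
Variables (C c s : R) (m : nat) (B : seq (seq nat)).
Hypothesis C1 : 1 <= C.
Hypothesis qg : quasi_multiplicative C (cylinder_length g).
Hypothesis qf : quasi_multiplicative C (cylinder_length f).
Hypothesis Bm : {in B, forall u, size u = m}.
Hypothesis uniqB : uniq B.
Hypothesis gain : {in B, forall u,
  C ^+ 2 * cylinder_length g (rcons u 1%N) <= cylinder_length f (rcons u 1%N)}.
Hypothesis c0 : 0 < c.
Hypothesis c1 : c < 1.
Hypothesis big : {in B, forall u, C * c <= cylinder_length g (rcons u 1%N)}.
Hypothesis s0 : 0 < s.
Hypothesis qcs : 1 <= (size B)%:R * c `^ s.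

Implicit Types (y t : R) (n : nat).

Let q : R := (size B)%:R.
Let digit y : nat := Num.trunc (q * y).
(** The expanding map [q * y] modulo 1, whose iterates read off the base-[q] digits of [y]. *)
Let rest y : R := q * y - (digit y)%:R.
(** The final letter makes the closed cylinders of different blocks disjoint, so a point of the
    Cantor set determines its prefixes even at endpoints. *)
Let block y : seq nat := rcons (nth [::] B (digit y)) 1%N.

(* Concatenates the blocks selected by the base-[size B] digits of [y]. *)
Let code y : nat -> nat :=
  fun j => nth 0%N (block (iter (j %/ m.+1) rest y)) (j %% m.+1).
Let prefix n y : seq nat := mkseq (code y) (n * m.+1).
Let p y : R := coding g (code y).

Let C0 : 0 < C. Proof. exact: lt_le_trans C1. Qed.

Let q1 : 1 < q.
Proof.
have cs : c `^ s < 1.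
  have := @gt0_ltr_powR R s s0 c 1; rewrite !nnegrE powR1; apply => //; exact: ltW.
have [q0|q0] := leP q 0; first by have := le_trans qcs (mulr_le0_ge0 q0 (powR_ge0 c s)); lra.
by apply: le_lt_trans qcs _; rewrite -[ltRHS]mulr1 ltr_pM2l.
Qed.

Let digit_lt y : 0 <= y < 1 -> (digit y < size B)%N.
Proof.
move=> /andP[y0 y1]; rewrite -(ltr_nat R).
have /Num.Theory.truncn_itv/andP[h1 _] : 0 <= q * y by rewrite mulr_ge0// ltW// (lt_trans _ q1).
apply: le_lt_trans h1 _; rewrite -[ltRHS]mulr1 ltr_pM2l//; exact: lt_trans q1.
Qed.

Let rest01 y : 0 <= y < 1 -> 0 <= rest y < 1.
Proof.
move=> /andP[y0 y1].
have /Num.Theory.truncn_itv/andP[h1 h2] : 0 <= q * y by rewrite mulr_ge0// ltW// (lt_trans _ q1).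
by rewrite /rest /digit; move: h2; rewrite -natr1; lra.
Qed.

Let block_mem y : 0 <= y < 1 -> nth [::] B (digit y) \in B.
Proof. by move=> /digit_lt; exact: mem_nth. Qed.

Let size_block y : 0 <= y < 1 -> size (block y) = m.+1.
Proof. by move=> /block_mem/Bm; rewrite /block size_rcons => ->. Qed.

Let prefixS n y : 0 <= y < 1 -> prefix n.+1 y = block y ++ prefix n (rest y).
Proof.
move=> y01; rewrite /prefix mulSn mkseqD; congr (_ ++ _).
- apply: (@eq_from_nth _ 0%N); rewrite size_mkseq ?size_block// => i im.
  by rewrite nth_mkseq// /code divn_small// modn_small.
- apply: eq_map => i; rewrite /code modnDl -{1}(mul1n m.+1) divnMDl//.
  by rewrite add1n iterSr.
Qed.

(** The factor [C ^+ 2] in [gain] pays for one use of quasi-multiplicativity for each of the two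
    maps, the factor [C] in [big] for one use for [g]; hence no constant accumulates with [n]. *)
Let prefix_len n y : 0 <= y < 1 ->
  cylinder_length g (prefix n y) <= cylinder_length f (prefix n y) /\
  c ^+ n <= cylinder_length g (prefix n y).
Proof.
elim: n y => [|n IH] y y01.
  by rewrite /prefix mul0n /mkseq /= !len_nil expr0.
have [IH1 IH2] := IH _ (rest01 y01); rewrite prefixS//.
have [g1 g2] := qg (block y) (prefix n (rest y)).
have [f1 f2] := qf (block y) (prefix n (rest y)).
have b1 := gain (block_mem y01); have b2 := big (block_mem y01).
have gp u := len_gt0 Hg u; have fp u := len_gt0 Hf u.
split.
- apply: le_trans g1 _; rewrite -(ler_pM2l C0); apply: le_trans f2.
  rewrite !mulrA -expr2; apply: ler_pM => //; rewrite ?mulr_ge0 ?exprn_ge0 ?ltW//.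
- rewrite -(ler_pM2l C0); apply: le_trans g2.
  by rewrite exprS mulrA; apply: ler_pM => //; rewrite ?mulr_ge0 ?exprn_ge0 ?ltW.
Qed.

Let prefix_close n y y' : 0 <= y < 1 -> 0 <= y' < 1 ->
  prefix n y = prefix n y' -> `|y - y'| <= q ^- n.
Proof.
have q0 : 0 < q by exact: lt_trans q1.
elim: n y y' => [|n IH] y y' y01 y'01.
  by rewrite expr0 invr1 ler_norml => _; lra.
rewrite !prefixS// => /eqP; rewrite eqseq_cat ?size_block// => /andP[/eqP bE /eqP].
move=> /(IH _ _ (rest01 y01) (rest01 y'01)).
have -> : rest y - rest y' = q * (y - y').
  rewrite /rest; have -> : digit y = digit y'; last by ring.
  apply/eqP; rewrite -(nth_uniq [::] _ _ uniqB) ?digit_lt//.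
  by have := f_equal (take m) bE; rewrite /block -!cats1 !take_cat !Bm ?block_mem//
    ltnn subnn !cats0 => ->.
rewrite normrM gtr0_norm// -ler_pdivlMl// => /le_trans; apply.
by rewrite exprS invfM.
Qed.

Let prefix_disjoint n y y' t t' : 0 <= y < 1 -> 0 <= y' < 1 ->
  t \in `[0, 1] -> t' \in `[0, 1] ->
  comp_word g (prefix n y) t = comp_word g (prefix n y') t' ->
  prefix n y = prefix n y'.
Proof.
elim: n y y' => [|n IH] y y' y01 y'01 t01 t'01 //.
rewrite !prefixS// !comp_word_cat => E.
have r01 := comp_word01 Hg (prefix n (rest y)) t01.
have r'01 := comp_word01 Hg (prefix n (rest y')) t'01.
have bE : block y = block y'.
  congr (rcons _ 1%N); apply: (disjoint_interior_cylinders Hg r01 r'01) E.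
  by rewrite !Bm ?block_mem.
by congr (_ ++ _) => //; apply: IH (rest01 y01) (rest01 y'01) t01 t'01 _;
  apply: (comp_word_inj Hg (u := block y)) => //; rewrite {2}bE.
Qed.

Let p_prefix n y : exists2 t, t \in `[0, 1] & p y = comp_word g (prefix n y) t.
Proof.
by exists (coding g (fun j => code y (n * m.+1 + j)%N)); [exact: (coding01 Hg)|exact: (coding_mkseq Hg)].
Qed.

(** All parameters whose level-[n] cylinder contains [b] have the same prefix, hence the same first
    [n] digits, and lie within [q ^- n] of any one of them. *)
Let cover_point n b : exists W : set R, [/\ measurable W,
  (lebesgue_measure W <= (2 * q ^- n)%:E)%E &
  forall y t, 0 <= y < 1 -> t \in `[0, 1] -> comp_word g (prefix n y) t = b -> W y].
Proof.
have qn0 : 0 <= q ^- n by rewrite invr_ge0 exprn_ge0// ltW// (lt_trans _ q1).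
have [[y0 [t0 [y01 t01 E]]]|N] := pselect (exists y t,
    [/\ 0 <= y < 1, t \in `[0, 1] & comp_word g (prefix n y) t = b]); last first.
  exists set0; rewrite measure0 lee_fin mulr_ge0//; split=> // y t y01 t01 E.
  by apply: N; exists y, t.
exists `[y0 - q ^- n, y0 + q ^- n]%classic; split.
- exact: measurable_itv.
- rewrite lebesgue_measure_itv/=; case: ifP => _; last by rewrite lee_fin mulr_ge0.
  by rewrite -EFinB lee_fin; lra.
- move=> y t y01' t01' E'; rewrite /= in_itv/=.
  have := prefix_close y01' y01 (prefix_disjoint y01' y01 t01' t01 (etrans E' (esym E))).
  by rewrite ler_norml; lra.
Qed.

Lemma finite_subsystem_dim :
  (s%:E <= hausdorff_dim [set x | (x \in `[0, 1] /\ ~ has_deriv01 h x 0)%R])%E.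
Proof.
have cs0 : 0 < c `^ s by rewrite powR_gt0.
have cs1 : c `^ s <= 1.
  have := @ge0_ler_powR R s (ltW s0) c 1; rewrite !nnegrE powR1; apply => //; exact: ltW.
have q0 : 0 < q by exact: lt_trans q1.
have y1 (y : R) : 0 <= y <= 1 -> ~ [set 1] y -> 0 <= y < 1.
  by move=> /andP[-> /=]; rewrite le_eqVlt => /predU1P[->|//]; case.
(* The parameter 1 is removed because digits are read on [[0, 1[]. The 4 comes from two ends with a
   set of measure [2 * q ^- n] each; the division by the [s]-th power of [c] pays for comparing [d]
   with [c ^+ n.+1] instead of [c ^+ n]. *)
apply: (@hausdorff_dim_ge _ s (4 / c `^ s) _ [set 1] p) => //.
- by rewrite divr_ge0 ?ltW.
- by rewrite lebesgue_measure_set1 lee_fin.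
- move=> y y01 /(y1 y y01) {}y01; split; first exact: (coding01 Hg).
  apply: (not_deriv0 Hg Hf Hh ltr01); first exact: (coding01 Hg).
  move=> d /(len_small Hg)[N HN].
  have [t t01 E] := p_prefix N y; exists (prefix N y), t; split=> //.
  + by apply: HN; rewrite /prefix size_mkseq leq_pmulr.
  + by rewrite mul1r; case: (prefix_len N y01).
move=> a d; rewrite le_eqVlt => /predU1P[<-|d0].
  (* For [d = 0] the set [W] must be null: parameters with the same image share all prefixes and are
     therefore equal. *)
  rewrite powR0 ?gt_eqF// mulr0 addr0.
  have [[y0 [y01 E]]|N] := pselect (exists y, 0 <= y < 1 /\ p y = a); last first.
    exists set0; rewrite measure0; split=> // y y01 /(y1 y y01) {}y01 /le_anti E.
    by apply: N; exists y.
  exists [set y0]; rewrite lebesgue_measure_set1; split=> //.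
  move=> y y01' /(y1 y y01') {}y01' /le_anti E' /=.
  apply/eqP; rewrite -subr_eq0 -normr_le0; apply/ler_addgt0Pl => e e0; rewrite addr0.
  have /cvgrPdist_lt/(_ _ e0)[n _ Hn] : q^-1 ^+ n @[n --> \oo] --> (0 : R).
    by apply: cvg_expr; rewrite ger0_norm ?invr_ge0 ?ltW// invf_lt1.
  have := Hn n (leqnn n); rewrite /= sub0r normrN exprVn => /ltW/(le_trans (ler_norm _)).
  apply: le_trans; have [t t01 Et] := p_prefix n y; have [t' t'01 Et'] := p_prefix n y0.
  apply: prefix_close => //; apply: prefix_disjoint t01 t'01 _ => //.
  by rewrite -Et -Et' E -E'.
have [d1|d1] := leP 1 d.
  exists `[0%R, 1%R]%classic; split=> [|| y y01 _ _]; first exact: measurable_itv.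
    rewrite lebesgue_measure_itv/= lte_fin ltr01 oppr0 adde0 lee_fin.
    have := @ge0_ler_powR R s (ltW s0) 1 d; rewrite !nnegrE powR1 => /(_ ler01 (ltW d0) d1) ds.
    apply: mulr_ege1 => //; rewrite ler_pdivlMr//; lra.
  by rewrite /= in_itv.
(* At level [n] every cylinder of the construction is still longer than [d], as [cylinder_meets_end]
   requires. *)
have [n [cn nc]] : exists n, d < c ^+ n /\ c ^+ n.+1 <= d.
  have /ex_minnP[[|n] nd minn] : exists n, c ^+ n <= d.
    have /cvgrPdist_lt/(_ _ d0)[n _ Hn] : c ^+ n @[n --> \oo] --> (0 : R).
      by apply: cvg_expr; rewrite ger0_norm// ltW.
    exists n; have := Hn n (leqnn n); rewrite /= sub0r normrN => /ltW.
    exact/le_trans/ler_norm.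
  - by move: nd; rewrite expr0 leNgt d1.
  - by exists n; split=> //; rewrite ltNge; apply/negP => /minn; rewrite ltnn.
have [W1 [mW1 muW1 HW1]] := cover_point n a.
have [W2 [mW2 muW2 HW2]] := cover_point n (a + d).
exists (W1 `|` W2); split; first exact: measurableU.
- apply: le_trans (lebesgue_measureU_le mW1 mW2 muW1 muW2) _.
  rewrite -EFinD lee_fin.
  have : q ^- n <= d `^ s / c `^ s.
    rewrite ler_pdivlMr//; apply: (@le_trans _ _ ((c ^+ n.+1) `^ s)); last first.
      by apply: ge0_ler_powR; rewrite ?nnegrE ?exprn_ge0// ltW.
    rewrite powR_exprn ?(ltW c0)// exprSr.
    rewrite ler_pM2r// -exprVn; apply: lerXn2r; rewrite ?nnegrE ?invr_ge0 ?(ltW q0) ?(ltW cs0)//.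
    by rewrite -div1r ler_pdivrMr// mulrC.
  have -> : 4 / c `^ s * d `^ s = 4 * (d `^ s / c `^ s) by ring.
  lra.
- move=> y y01 /(y1 y y01) {}y01 apd.
  have [t t01 E] := p_prefix n y; move: apd; rewrite E => apd.
  have [_ cl] := prefix_len n y01.
  have [b [t' [bE t'01 Eb]]] := cylinder_meets_end Hg t01 apd (lt_le_trans cn cl).
  by case: bE Eb => -> Eb; [left; apply: HW1 Eb|right; apply: HW2 Eb].
Qed.

End FiniteSubsystem.

(** * Finite families of words with comparable lengths *)

Section ManyEqualWords.
Context {R : realType} {o : orientation} {T : R -> R} {f : nat -> R -> R}.
Hypothesis Hf : countable_markov_map o T f.
Hypothesis finf : finite_potential f.
Variable V : R.
Hypothesis sumV : (sum_variations (potential f) <= V%:E)%E.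
Local Notation len := (cylinder_length f).

(** The omitted children fill the image under [u] of [[0, upper_end f N]], which by bounded
    distortion is at most the fraction [expR V * upper_end f N] of the cylinder. *)
Lemma sum_rcons_ge N u :
  len u * (1 - expR V * upper_end f N) <= \sum_(i < N) len (rcons u i).
Proof.
have := len_sub_sum Hf N u.
have := dist_ratio Hf finf sumV u (upper_end01 Hf N) in01_0 in01_1 in01_0.
rewrite !subr0 normr1 mulr1 (gtr0_norm (upper_end_gt0 Hf N)) => h /eqP.
rewrite subr_eq addrC -subr_eq => /eqP <-; rewrite mulrBr mulr1 lerD2l lerN2.
by rewrite (le_trans h)// mulrCA.
Qed.

Lemma sum_words_len_ge N n :
  1 - n%:R * (expR V * upper_end f N) <= \sum_(u <- words N n) len u.
Proof.
elim: n => [|n IH].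
  by rewrite [words N 0]/words /= big_seq1 len_nil mul0r subr0.
rewrite sum_words_rcons.
apply: (@le_trans _ _ (\sum_(u <- words N n) len u * (1 - expR V * upper_end f N))); last first.
  by apply: ler_sum => u _; exact: sum_rcons_ge.
rewrite -mulr_suml mulrBr mulr1 -natr1 mulrDl mul1r opprD addrA lerD// lerN2.
have Ve : 0 <= expR V * upper_end f N.
  by rewrite mulr_ge0 ?expR_ge0// ltW// (upper_end_gt0 Hf).
by rewrite ler_piMl// (sum_words_len_le1 Hf).
Qed.

Lemma exists_words_len_ge n : exists N, 2^-1 <= \sum_(u <- words N n) len u.
Proof.
have d0 : 0 < (2 * (n%:R + 1) * expR V)^-1.
  by rewrite invr_gt0 !mulr_gt0 ?expR_gt0// ltr_wpDl.
have /cvgrPdist_lt/(_ _ d0)[N _ HN] := upper_end_cvg Hf.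
exists N; apply: le_trans (sum_words_len_ge N n).
have := HN N (leqnn N); rewrite /= sub0r normrN gtr0_norm ?(upper_end_gt0 Hf)//.
have n0 : 0 <= n%:R :> R by [].
have V0 := expR_gt0 V; have e0 := upper_end_gt0 Hf N.
rewrite -(ltr_pM2r (_ : 0 < 2 * (n%:R + 1) * expR V)) ?mulr_gt0 ?ltr_wpDl//.
rewrite mulVf ?gt_eqF ?mulr_gt0 ?ltr_wpDl// => h.
have : 0 <= expR V * upper_end f N by rewrite mulr_ge0 ?ltW.
move: h; rewrite (_ : upper_end f N * (2 * (n%:R + 1) * expR V) =
  2 * (n%:R * (expR V * upper_end f N)) + 2 * (expR V * upper_end f N)); last by ring.
lra.
Qed.

(* If every dyadic class of words of length [n] were small, their lengths could
   not add up to [1/2] for large [n]. *)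
Lemma exists_many_words (s K : R) : 0 < s -> s < 1 -> 0 < K ->
  exists n (A : seq (seq nat)) rho, [/\ uniq A, {in A, forall u, size u = n},
    0 < rho, {in A, forall u, rho <= len u} & K <= (size A)%:R * rho `^ s].
Proof.
(* If class [j] has fewer words than wanted, its total length is at most [2 * K * beta ^+ j]. As
   [s < 1] this is a convergent geometric series, and [J] is chosen to make its tail less than
   1/2. *)
move=> s0 s1 K0; pose beta : R := 2^-1 `^ (1 - s).
have b0 : 0 < beta by rewrite powR_gt0.
have b1 : beta < 1.
  have := @gt0_ltr_powR R (1 - s) _ 2^-1 1; rewrite !nnegrE powR1 subr_gt0.
  by apply => //; lra.
have [J HJ] : exists J, 2 * K * (beta ^+ J / (1 - beta)) < 2^-1.
  have d0 : 0 < (1 - beta) / (4 * K).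
    by rewrite divr_gt0 ?mulr_gt0 ?subr_gt0.
  have /cvgrPdist_lt/(_ _ d0)[J _ H] : beta ^+ n @[n --> \oo] --> (0 : R).
    by apply: cvg_expr; rewrite gtr0_norm.
  exists J; have := H J (leqnn J); rewrite /= sub0r normrN gtr0_norm ?exprn_gt0//.
  rewrite ltr_pdivlMr ?mulr_gt0// => h.
  rewrite mulrA ltr_pdivrMr ?subr_gt0//; lra.
have hJ0 : 0 < 2^-1 ^+ J :> R by rewrite exprn_gt0.
(* Long words are short intervals, so only the classes from [J] on occur. *)
have [n Hn] := len_small Hf hJ0.
have [N HN] := exists_words_len_ge n.
have [jf Hjf] : {jf : seq nat -> nat & forall u, 2^-1 ^+ (jf u).+1 < len u <= 2^-1 ^+ jf u}.
  apply: (@choice _ _ (fun u j => 2^-1 ^+ j.+1 < len u <= 2^-1 ^+ j)) => u.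
  have /ex_minnP[j Hj minj] : exists j, 2^-1 ^+ j.+1 < len u.
    have /cvgrPdist_lt/(_ _ (len_gt0 Hf u))[j _ H] : 2^-1 ^+ n @[n --> \oo] --> (0 : R).
      by apply: cvg_expr; rewrite gtr0_norm// invf_lt1// ltr1n.
    exists j; have := H j.+1 (leqnSn j).
    by rewrite /= sub0r normrN gtr0_norm// exprn_gt0.
  exists j; rewrite Hj /= leNgt; apply/negP.
  case: j minj {Hj} => [_|j minj /minj]; last by rewrite ltnn.
  by rewrite expr0 ltNge (len_le1 Hf).
pose W := words N n; pose cls j := [seq u <- W | jf u == j].
have [[j Hj]|none] := pselect (exists j, K <= (size (cls j))%:R * (2^-1 ^+ j.+1) `^ s).
  exists n, (cls j), (2^-1 ^+ j.+1); split=> //.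
  - by rewrite filter_uniq// uniq_words.
  - by move=> u; rewrite mem_filter mem_words => /and3P[_ /eqP].
  - by move=> u; rewrite mem_filter => /andP[/eqP <- _]; case/andP: (Hjf u) => /ltW.
exfalso; pose M := (\max_(u <- W) jf u).+1.
have rng u : u \in W -> (J <= jf u < M)%N.
  move=> uW; rewrite /M ltnS leq_bigmax_seq// andbT.
  move: uW; rewrite mem_words => /andP[/eqP un _].
  have /andP[h _] := Hjf u; have := lt_trans h (Hn u _); rewrite un leqnn => /(_ isT).
  by rewrite ltr_iXn2l ?invr_gt0// ?invf_lt1 ?ltr1n.
have : \sum_(u <- W) len u <= \sum_(J <= j < M) 2^-1 ^+ j * (size (cls j))%:R.
  apply: (@le_trans _ _ (\sum_(u <- W) \sum_(J <= j < M) 2^-1 ^+ j * (jf u == j)%:R)).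
    rewrite big_seq [leRHS]big_seq; apply: ler_sum => u uW.
    have := rng u uW; rewrite -mem_index_iota => jm.
    rewrite (bigD1_seq _ jm (iota_uniq _ _))/= eqxx mulr1.
    by case/andP: (Hjf u) => _ /le_trans; apply; rewrite lerDl sumr_ge0// => j _; rewrite mulr_ge0.
  rewrite exchange_big /=; apply: ler_sum => j _.
  rewrite -mulr_sumr ler_wpM2l ?exprn_ge0//.
  by rewrite -natr_sum ler_nat size_filter -sum1_count [leqRHS]big_mkcond.
apply/negP; rewrite -ltNge; apply: lt_le_trans HN.
apply: le_lt_trans HJ.
apply: (@le_trans _ _ (\sum_(J <= j < M) 2 * K * beta ^+ j)).
  apply: ler_sum => j _.
  have : (size (cls j))%:R * (2^-1 ^+ j.+1) `^ s <= K.
    by rewrite leNgt; apply/negP => /ltW h; apply: none; exists j.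
  rewrite powR_exprn// -ler_pdivlMr ?exprn_gt0 ?powR_gt0// => h.
  apply: (@le_trans _ _ (2^-1 ^+ j * (K / (2^-1 `^ s) ^+ j.+1))).
    by rewrite ler_wpM2l ?exprn_ge0.
  have -> : 2^-1 ^+ j * (K / (2^-1 `^ s) ^+ j.+1) =
     (2^-1 `^ s)^-1 * K * (2^-1 / 2^-1 `^ s) ^+ j.
    by rewrite exprS invfM expr_div_n; ring.
  have <- : beta = 2^-1 / 2^-1 `^ s.
    rewrite /beta powRD; last by rewrite invr_eq0 pnatr_eq0 implybT.
    by rewrite powRN powRr1// invr_ge0.
  rewrite ler_pM2r ?exprn_gt0// ler_pM2r//.
  rewrite invf_ple ?posrE ?powR_gt0//.
  rewrite -[leLHS](powRr1 (_ : 0 <= 2^-1))//.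
  by apply: ger_powR; [lra|exact: ltW].
rewrite -mulr_sumr ler_pM2l ?mulr_gt0//.
have [JM|MJ] := leqP J M; last first.
  by rewrite big_geq 1?ltnW// divr_ge0 ?exprn_ge0 ?(ltW b0)// subr_ge0 (ltW b1).
rewrite ler_pdivlMr ?subr_gt0// mulrBr mulr1 mulr_suml.
under [X in _ - X]eq_bigr do rewrite -exprSr.
rewrite -sumrB -(opprK (\sum_(_ <= _ < _) _)) -sumrN.
under eq_bigr do rewrite opprB.
by rewrite telescope_sumr// opprB lerBlDr lerDl exprn_ge0 ?(ltW b0).
Qed.

End ManyEqualWords.

Lemma quasi_multiplicative3 (R : realType) (C : R) (len : seq nat -> R) :
  0 < C -> (forall u, 0 < len u) -> quasi_multiplicative C len ->
  forall u v w, len ((u ++ v) ++ w) <= C ^+ 2 * (len u * len v * len w) /\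
    len u * len v * len w <= C ^+ 2 * len ((u ++ v) ++ w).
Proof.
move=> C0 len0 qm u v w; have [u1 u2] := qm (u ++ v) w; have [v1 v2] := qm u v.
split.
- apply: le_trans u1 _; apply: (@le_trans _ _ (C * (C * (len u * len v) * len w))).
    by rewrite ler_pM2l// ler_pM2r.
  by rewrite expr2 !mulrA.
- apply: (@le_trans _ _ (C * len (u ++ v) * len w)); first by rewrite ler_pM2r.
  by rewrite expr2 -!mulrA ler_pM2l.
Qed.

(** * Inserting the short letter between strings of test words *)

Section InsertedLetter.
Context {R : realType} {o : orientation}.
Context {S : R -> R} {g : nat -> R -> R} {T : R -> R} {f : nat -> R -> R} {h : R -> R}.
Hypothesis Hg : countable_markov_map o S g.
Hypothesis Hf : countable_markov_map o T f.
Hypothesis Hh : conjugacy S g T f h.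
Variable C : R.
Hypothesis C1 : 1 <= C.
Hypothesis qg : quasi_multiplicative C (cylinder_length g).
Hypothesis qf : quasi_multiplicative C (cylinder_length f).
(** For [l >= 1], [Q ^+ l] exceeds [2 * C ^+ 6 * (2 * C ^+ 2) ^+ l], the whole loss in comparing the
    two lengths of a block made of [l] test words, the letter [j] and the letter 1, including the
    factor that [gain] demands. *)
Local Notation Q := (4 * C ^+ 8).
Local Notation a1 := (cylinder_length f [:: 1%N]).
(** The length that a block loses, per test word: [2 * C] for changing the map and concatenating,
    [Q ^+ 4] for the letter [j], and the last factor for the closing letter 1. Charging the last
    factor to each word makes the bound for a block an exact [l]-th power. *)
Local Notation kappa := ((2 * C)^-1 * Q ^- 4 * (a1 / (2 * C ^+ 3))).

Let C0 : 0 < C. Proof. exact: lt_le_trans C1. Qed.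

Lemma word_pow_len (A : seq (seq nat)) (rho : R) l :
  0 < rho -> {in A, forall u, rho <= cylinder_length f u} ->
  {in A, forall u, cylinder_length f u / 2 <= cylinder_length g u <= 2 * cylinder_length f u} ->
  {in word_pow A l, forall u,
    cylinder_length g u <= (2 * C ^+ 2) ^+ l * cylinder_length f u /\
    (rho / (2 * C)) ^+ l <= cylinder_length g u}.
Proof.
move=> rho0 Arho near; elim: l => [|l IH] u /=.
  by rewrite inE => /eqP ->; rewrite !len_nil !expr0 mulr1.
move=> /allpairsP[[v w] /= [vA wA ->]]; have [IH1 IH2] := IH w wA.
have /andP[n1 n2] := near v vA; have rv := Arho v vA.
have [g1 g2] := qg v w; have [_ f2] := qf v w.
have gp u' := len_gt0 Hg u'; have fp u' := len_gt0 Hf u'.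
have Cp : 0 <= (2 * C ^+ 2) ^+ l by rewrite !(exprn_ge0, mulr_ge0)// ltW.
split.
- apply: le_trans g1 _.
  apply: (@le_trans _ _ (C * ((2 * cylinder_length f v) * ((2 * C ^+ 2) ^+ l * cylinder_length f w)))).
    by rewrite ler_pM2l//; apply: ler_pM => //; exact: ltW.
  have -> : C * (2 * cylinder_length f v * ((2 * C ^+ 2) ^+ l * cylinder_length f w)) =
    2 * C * (2 * C ^+ 2) ^+ l * (cylinder_length f v * cylinder_length f w) by ring.
  have -> : (2 * C ^+ 2) ^+ l.+1 * cylinder_length f (v ++ w) =
    2 * C * (2 * C ^+ 2) ^+ l * (C * cylinder_length f (v ++ w)) by rewrite exprS; ring.
  apply: ler_wpM2l => //; apply: mulr_ge0 => //; apply: mulr_ge0 => //; exact: ltW.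
- rewrite -(ler_pM2l C0); apply: le_trans g2; rewrite exprS mulrA.
  have -> : C * (rho / (2 * C)) = rho / 2 by rewrite invfM; field; rewrite gt_eqF.
  apply: ler_pM => //; first by rewrite divr_ge0// ltW.
    by rewrite exprn_ge0// divr_ge0 ?mulr_ge0// ltW.
  by apply: le_trans n1; rewrite ler_pM2r.
Qed.

Lemma inserted_letter_dim (s rho : R) (A : seq (seq nat)) n j :
  0 < s -> s < 1 -> uniq A -> {in A, forall u, size u = n} ->
  0 < rho -> {in A, forall u, rho <= cylinder_length f u} ->
  kappa^-1 <= (size A)%:R * rho `^ s ->
  {in [:: 1%N] :: A, forall u,
    cylinder_length f u / 2 <= cylinder_length g u <= 2 * cylinder_length f u} ->
  cylinder_length g [:: j] < Q^-1 * cylinder_length f [:: j] ^+ 2 ->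
  (s%:E <= hausdorff_dim [set x | (x \in `[0, 1] /\ ~ has_deriv01 h x 0)%R])%E.
Proof.
move=> s0 s1 uA An rho0 Arho KA near lj.
set a := cylinder_length f [:: j] in lj; set b := cylinder_length g [:: j] in lj.
have a0 : 0 < a := len_gt0 Hf _; have b0 : 0 < b := len_gt0 Hg _.
have ale1 : a <= 1 := len_le1 Hf _.
have a10 : 0 < a1 := len_gt0 Hf _; have a11 : a1 <= 1 := len_le1 Hf _.
have CX k : 1 <= C ^+ k by exact: exprn_ege1.
have CX0 k : 0 < C ^+ k by rewrite exprn_gt0.
have Q4 : 4 <= Q by rewrite ler_peMr.
have Q0 : 0 < Q by lra.
have Q1 : 1 <= Q by lra.
have ba : Q * b < a ^+ 2 by rewrite -ltr_pdivlMl.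
have bQ : Q * b <= a by rewrite (le_trans (ltW ba))// expr2 ler_piMr// ltW.
(* [l] is the largest exponent with [Q ^+ l * b <= a]. Maximality and [Q * b < a ^+ 2] give
   [b <= a ^+ 2 <= (Q ^+ l.+1 * b) ^+ 2], so [1 <= b * Q ^+ (2 * l.+1)], and [2 * l.+1 <= 4 * l]
   because [l] is positive. *)
have [l [l0 Ql bl]] : exists l, [/\ (0 < l)%N, Q ^+ l * b <= a & 1 <= b * Q ^+ (4 * l)].
  have /ex_minnP[[|l] Hl minl] : exists l, a < Q ^+ l * b.
    have /cvgrPdist_lt/(_ _ (divr_gt0 b0 a0))[k _ Hk] : Q^-1 ^+ n @[n --> \oo] --> (0 : R).
      apply: cvg_expr; rewrite gtr0_norm ?invr_gt0// invf_lt1//; lra.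
    exists k; have := Hk k (leqnn k).
    rewrite /= sub0r normrN gtr0_norm ?exprn_gt0 ?invr_gt0// ltr_pdivlMr// exprVn.
    by rewrite ltr_pdivrMl ?exprn_gt0.
  - by move: Hl; rewrite expr0 mul1r ltNge (le_trans _ bQ)// ler_peMl// ltW.
  have l0 : (0 < l)%N by case: l Hl minl => // Hl _; move: Hl; rewrite expr1 ltNge bQ.
  exists l; split=> //.
    by rewrite leNgt; apply/negP => /minl; rewrite ltnn.
  have bb : 0 < b ^+ 2 by rewrite exprn_gt0.
  have : a ^+ 2 <= (Q ^+ l.+1 * b) ^+ 2 by rewrite lerXn2r ?nnegrE ?mulr_ge0 ?exprn_ge0 ?ltW.
  rewrite exprMn -exprM => h2.
  have : b * 1 <= b * (b * Q ^+ (l.+1 * 2)).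
    apply: le_trans (le_trans (ltW ba) _); first by rewrite mulrC ler_pM2r.
    by apply: le_trans h2 _; rewrite mulrA -expr2 mulrC.
  rewrite ler_pM2l// => /le_trans; apply; rewrite ler_pM2l//.
  by apply: ler_weXn2l => //; move: l0; clear; lia.
have sA : (0 < size A)%N.
  rewrite lt0n; apply/eqP => sA; move: KA; rewrite sA mul0r invr_le0 leNgt.
  by rewrite !mulr_gt0 ?invr_gt0 ?exprn_gt0 ?mulr_gt0.
have rho1 : rho <= 1.
  have /(mem_nth [::]) m := sA; exact: le_trans (Arho _ m) (len_le1 Hf _).
have k0 : 0 < kappa by rewrite !mulr_gt0 ?invr_gt0 ?exprn_gt0 ?mulr_gt0.
have a1C : a1 / (2 * C ^+ 3) <= 2^-1.
  rewrite ler_pdivrMr ?mulr_gt0// mulrA mulVf ?pnatr_eq0// mul1r.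
  exact: le_trans a11 (CX 3%N).
have a1C0 : 0 < a1 / (2 * C ^+ 3) by rewrite divr_gt0 ?mulr_gt0.
have k1 : kappa < 1.
  apply: (@le_lt_trans _ _ (a1 / (2 * C ^+ 3))); last first.
    by rewrite (le_lt_trans a1C)// invf_lt1// ltr1n.
  have i1 : (2 * C)^-1 <= 1.
    by rewrite invf_le1 ?mulr_gt0// (le_trans C1)// ler_peMl ?(ltW C0)// ler1n.
  have i2 : Q ^- 4 <= 1 by rewrite invf_le1 ?exprn_gt0// exprn_ege1.
  rewrite ler_piMl ?(ltW a1C0)// mulr_ile1// invr_ge0.
    by rewrite mulr_ge0 ?(ltW C0).
  by rewrite exprn_ge0 ?(ltW Q0).
pose c := (rho * kappa) ^+ l; pose B := [seq rcons u j | u <- word_pow A l].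
have rk0 : 0 < rho * kappa by rewrite mulr_gt0.
have rk1 : rho * kappa < 1 by rewrite (le_lt_trans _ k1)// ler_piMl// ltW.
have nearA : {in A, forall u,
    cylinder_length f u / 2 <= cylinder_length g u <= 2 * cylinder_length f u}.
  by move=> u uA'; apply: near; rewrite inE uA' orbT.
have near1 := near _ (mem_head _ _).
have gp u := len_gt0 Hg u; have fp u := len_gt0 Hf u.
have split_g u := quasi_multiplicative3 C0 gp qg u [:: j] [:: 1%N].
have split_f u := (quasi_multiplicative3 C0 fp qf u [:: j] [:: 1%N]).2.
apply: (@finite_subsystem_dim _ _ _ _ _ _ _ Hg Hf Hh C c s (l * n).+1 B) => //.
- move=> _ /mapP[u uP ->]; rewrite size_rcons; congr _.+1.
  exact: size_in_word_pow An uP.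
- by rewrite map_inj_uniq; [exact: uniq_word_pow An uA|exact: rcons_injl].
- move=> _ /mapP[u uP ->]; rewrite -!cats1.
  have [w1 _] := word_pow_len rho0 Arho nearA uP.
  have [g1 _] := split_g u; have f1 := split_f u; have /andP[_ n2] := near1.
  rewrite -(ler_pM2l (CX0 2%N)); apply: le_trans f1; rewrite mulrA -exprD.
  apply: (@le_trans _ _ (C ^+ (2 + 2) * (C ^+ 2 *
     ((2 * C ^+ 2) ^+ l * cylinder_length f u * b * (2 * a1))))).
    rewrite ler_pM2l//; apply: le_trans g1 _; rewrite ler_pM2l//.
    rewrite -/b; apply: ler_pM n2; rewrite ?mulr_ge0 ?(ltW (gp _)) ?(ltW b0)//.
    by rewrite ler_pM2r.
  have -> : C ^+ (2 + 2) * (C ^+ 2 * ((2 * C ^+ 2) ^+ l * cylinder_length f u * b * (2 * a1)))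
    = (2 * C ^+ 6 * (2 * C ^+ 2) ^+ l * b) * (cylinder_length f u * a1) by ring.
  have -> : cylinder_length f u * a * a1 = a * (cylinder_length f u * a1) by ring.
  rewrite ler_pM2r ?mulr_gt0//; apply: le_trans Ql; rewrite ler_pM2r//.
  have -> : 2 * C ^+ 6 * (2 * C ^+ 2) ^+ l = (2 * 2 ^+ l) * C ^+ (6 + 2 * l).
    by rewrite exprMn exprD exprM; ring.
  rewrite exprMn -exprM; apply: ler_pM.
  + by rewrite mulr_ge0 ?exprn_ge0.
  + exact: ltW.
  + have -> : 4 = 2 ^+ 2 :> R by rewrite -natrX.
    by rewrite -exprM -exprS; apply: ler_weXn2l; rewrite ?ler1n//; move: l0; clear; lia.
  + by apply: ler_weXn2l => //; move: l0; clear; lia.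
- by rewrite exprn_gt0.
- by rewrite exprn_ilt1 ?ltW// -lt0n.
- move=> _ /mapP[u uP ->]; rewrite -!cats1.
  have [_ w2] := word_pow_len rho0 Arho nearA uP.
  have [_ g2] := split_g u; have /andP[n1 _] := near1.
  rewrite -(ler_pM2l (CX0 2%N)); apply: le_trans g2.
  have -> : C ^+ 2 * (C * c) = C ^+ 3 * c by ring.
  have -> : c = (rho / (2 * C)) ^+ l * (Q ^- 4) ^+ l * (a1 / (2 * C ^+ 3)) ^+ l.
    by rewrite /c !exprMn; ring.
  apply: (@le_trans _ _ ((rho / (2 * C)) ^+ l * b * (a1 / 2))); last first.
    rewrite -/b; apply: ler_pM n1; last by rewrite ler_pM2r.
      by rewrite mulr_ge0 ?(ltW b0)// exprn_ge0// divr_ge0 ?mulr_ge0 ?(ltW C0) ?(ltW rho0).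
    by rewrite divr_ge0 ?(ltW a10).
  have X0 : 0 < (rho / (2 * C)) ^+ l by rewrite exprn_gt0// divr_gt0// mulr_gt0.
  have Y0 : 0 < (Q ^- 4) ^+ l by rewrite exprn_gt0// invr_gt0 exprn_gt0.
  have Z0 : 0 < (a1 / (2 * C ^+ 3)) ^+ l by rewrite exprn_gt0.
  have swap (x y z w : R) : w * (x * y * z) = x * y * (w * z) by ring.
  rewrite swap; apply: ler_pM.
  + by rewrite ltW// mulr_gt0.
  + by rewrite ltW// mulr_gt0.
  + rewrite ler_pM2l//.
    by rewrite exprVn -exprM -div1r ler_pdivrMr// exprn_gt0.
  + case: l l0 {Ql bl c B X0 Y0 Z0 w2 uP} => // l _; rewrite (exprS _ l) mulrA.
    have -> : C ^+ 3 * (a1 / (2 * C ^+ 3)) = a1 / 2.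
      by field; rewrite gt_eqF.
    rewrite ler_piMr ?divr_ge0 ?(ltW a10)// exprn_ile1 ?(ltW a1C0)//.
    by rewrite (le_trans a1C)// invf_le1// ler1n.
- rewrite size_map size_word_pow natrX /c powR_exprn ?(ltW rk0)// -exprMn exprn_ege1//.
  rewrite powRM ?(ltW rho0) ?(ltW k0)// mulrA.
  (* Since [kappa] and [s] are below 1, raising [kappa] to the power [s] does not decrease it; the
     count of test words was chosen to beat [kappa]. *)
  apply: (@le_trans _ _ ((size A)%:R * rho `^ s * kappa)).
    by rewrite -ler_pdivrMr// div1r.
  rewrite ler_wpM2l ?mulr_ge0 ?powR_ge0//.
  rewrite -[leLHS](powRr1 (ltW k0)); apply: ger_powR; last exact: ltW.
  by rewrite k0 ltW.
Qed.

End InsertedLetter.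

(** * No much shorter letter *)

Lemma powRD_gt0 (R : realType) (x r s : R) : 0 < x -> x `^ (r + s) = x `^ r * x `^ s.
Proof. by move=> x0; apply: powRD; rewrite (gt_eqF x0) implybT. Qed.

Section CylinderMeasure.
Context {R : realType} {o : orientation} {T : R -> R} {f : nat -> R -> R}.
Hypothesis Hf : countable_markov_map o T f.

Lemma cylinder_itvE u : comp_word f u @` `[0, 1] =
  `[Num.min (comp_word f u 0) (comp_word f u 1),
    Num.max (comp_word f u 0) (comp_word f u 1)]%classic.
Proof.
apply/seteqP; split=> [_ [y y01 <-]|z].
  have := comp_word_dist_le Hf u y01 in01_0; have := comp_word_dist_le Hf u y01 in01_1.
  rewrite /= in_itv/= /cylinder_length.
  by have [l|l] := leP (comp_word f u 0) (comp_word f u 1); rewrite !ler_norml;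
    [rewrite (@ger0_norm _ (_ - _)) ?subr_ge0//|rewrite (@ltr0_norm _ (_ - _)) ?subr_lt0//]; lra.
rewrite /= in_itv/=; have [l|l] := leP (comp_word f u 0) (comp_word f u 1) => zi.
- by have [y y01 yz] := comp_word_interval Hf in01_0 in01_1 zi; exists y.
- by have [y y01 yz] := comp_word_interval Hf in01_1 in01_0 zi; exists y.
Qed.

Lemma measurable_cylinder u : measurable (comp_word f u @` `[0, 1]).
Proof. by rewrite cylinder_itvE; exact: measurable_itv. Qed.

Lemma lebesgue_measure_cylinder u :
  lebesgue_measure (comp_word f u @` `[0, 1]) = (cylinder_length f u)%:E.
Proof.
rewrite cylinder_itvE lebesgue_measure_itv/= lte_fin /cylinder_length.
have [l|l|E] := ltgtP (comp_word f u 0) (comp_word f u 1).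
- by rewrite l -EFinB gtr0_norm// subr_gt0.
- by rewrite l -EFinB ltr0_norm ?subr_lt0// opprB.
- by rewrite E ltxx subrr normr0.
Qed.

End CylinderMeasure.

(** * Lebesgue-typical points in the image coordinate *)

Section LebesgueTypical.
Context {R : realType} {o : orientation}.
Context {S : R -> R} {g : nat -> R -> R} {T : R -> R} {f : nat -> R -> R} {h : R -> R}.
Hypothesis Hg : countable_markov_map o S g.
Hypothesis Hf : countable_markov_map o T f.
Hypothesis Hh : conjugacy S g T f h.
Local Notation lenf := (cylinder_length f).
Local Notation leng := (cylinder_length g).
Local Notation mu := (@lebesgue_measure R).
Implicit Types (u v : seq nat) (x y : R).

Variables (C c0 t s delta : R) (d N0 : nat).
Hypothesis C1 : 1 <= C.
Hypothesis qg : quasi_multiplicative C leng.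
Hypothesis qf : quasi_multiplicative C lenf.
Hypothesis c00 : 0 < c0.
Hypothesis t0 : 0 < t.
Hypothesis delta0 : 0 < delta.
Hypothesis t_delta : t + 2 * delta = 1.
Hypothesis s0 : 0 < s.
Hypothesis d0 : (0 < d)%N.
Local Notation tau := (s^-1).
Local Notation powsum N := (\sum_(i < N) lenf [:: val i] `^ t).
Local Notation CY := (C * C `^ delta).
Local Notation K1 := (CY / c0 `^ delta).
Local Notation CX := (CY * C `^ (tau * delta)).
Hypothesis letters : forall j, c0 * lenf [:: j] ^+ 2 <= leng [:: j].
Hypothesis short : forall v, size v = d ->
  CX * (2 * lenf v `^ ((tau - 1) * delta)) <= 4^-1.
Hypothesis tail : forall N, (N0 <= N)%N ->
  CX * (K1 ^+ d * (powsum N ^+ d - powsum N0 ^+ d)) <= 4^-1.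
Hypothesis near : {in words N0 d, forall v, lenf v / 2 <= leng v}.
Variable P : R.
Hypothesis powsumP : forall N, powsum N <= P.

Let C0 : 0 < C. Proof. exact: lt_le_trans C1. Qed.
Let tau0 : 0 < tau. Proof. by rewrite invr_gt0. Qed.
Let gp u : 0 < leng u. Proof. exact: len_gt0 Hg u. Qed.
Let fp u : 0 < lenf u. Proof. exact: len_gt0 Hf u. Qed.
Let Cd0 : 0 < C `^ delta. Proof. exact: powR_gt0. Qed.
Let CY0 : 0 < CY. Proof. exact: mulr_gt0. Qed.
Let CX0 : 0 < CX. Proof. by rewrite mulr_gt0// powR_gt0. Qed.
Let K10 : 0 < K1. Proof. by rewrite divr_gt0// powR_gt0. Qed.

Let Y u := lenf u / leng u `^ delta.
(** This is [a u * (a u ^ tau / b u) ^ delta], the exponential moment of the Chernoff bound for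
    failure of the Hoelder estimate. [Y] omits the factor [a u ^ (tau * delta)]; it serves for the
    extension [v] when [b (u ++ v)] is compared with [a u] alone. *)
Let X u := Y u * lenf u `^ (tau * delta).

Let Y0 u : 0 < Y u. Proof. by rewrite divr_gt0// powR_gt0. Qed.
Let X0 u : 0 < X u. Proof. by rewrite mulr_gt0// powR_gt0. Qed.

Let powR_le (a b r : R) : 0 < r -> 0 <= a -> a <= b -> a `^ r <= b `^ r.
Proof.
move=> r0 a0 ab; apply: ge0_ler_powR => //; rewrite ?nnegrE ?(ltW r0)//.
exact: le_trans ab.
Qed.

Let Y_cat u v : Y (u ++ v) <= CY * (Y u * Y v).
Proof.
have [_ g2] := qg u v; have [f1 _] := qf u v.
have h1 : (leng u * leng v) `^ delta <= (C * leng (u ++ v)) `^ delta.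
  by apply: powR_le => //; rewrite mulr_ge0// ltW.
rewrite !powRM ?(ltW (gp _)) ?(ltW C0)// in h1.
have q0 w : 0 < leng w `^ delta by rewrite powR_gt0.
rewrite /Y ler_pdivrMr//; apply: le_trans f1 _.
have -> : CY * (lenf u / leng u `^ delta * (lenf v / leng v `^ delta)) * leng (u ++ v) `^ delta =
  C * (lenf u * lenf v) *
    ((C `^ delta * leng (u ++ v) `^ delta) / (leng u `^ delta * leng v `^ delta)).
  by rewrite invfM; ring.
by rewrite ler_peMr ?mulr_ge0 ?(ltW C0) ?(ltW (fp _))// ler_pdivlMr ?mulr_gt0// mul1r.
Qed.

Let X_cat u v : X (u ++ v) <= CX * (X u * X v).
Proof.
have [f1 _] := qf u v.
have h1 : lenf (u ++ v) `^ (tau * delta) <= (C * (lenf u * lenf v)) `^ (tau * delta).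
  by apply: powR_le f1; [exact: mulr_gt0|exact: ltW].
rewrite !powRM ?mulr_ge0 ?(ltW (fp _)) ?(ltW C0)// in h1.
have -> : CX * (X u * X v) = (CY * (Y u * Y v)) *
   (C `^ (tau * delta) * (lenf u `^ (tau * delta) * lenf v `^ (tau * delta))).
  by rewrite /X; ring.
by apply: ler_pM => //; rewrite ?powR_ge0// ltW.
Qed.

Let X_le_Y u : X u <= Y u.
Proof.
rewrite /X ler_piMr ?(ltW (Y0 u))//.
have := @powR_le (lenf u) 1 (tau * delta); rewrite powR1; apply.
- by rewrite mulr_gt0.
- exact: ltW.
- exact: len_le1 Hf u.
Qed.

(** For one letter, [letters] bounds [Y] by a constant times the length to the power
    [1 - 2 * delta = t]. This controls arbitrarily far letters of [g], about which nothing else is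
    known. *)
Let Y_letters v : Y v <= K1 ^+ size v * \prod_(i <- v) lenf [:: i] `^ t.
Proof.
have Y1 i : Y [:: i] <= (c0 `^ delta)^-1 * lenf [:: i] `^ t.
  rewrite /Y ler_pdivrMr ?powR_gt0//.
  have h1 : c0 `^ delta * (lenf [:: i] ^+ 2) `^ delta <= leng [:: i] `^ delta.
    rewrite -powRM ?(ltW c00) ?exprn_ge0 ?(ltW (fp _))//; apply: powR_le => //.
    by rewrite mulr_ge0 ?exprn_ge0 ?(ltW c00) ?(ltW (fp _)).
  have E : lenf [:: i] = lenf [:: i] `^ t * (lenf [:: i] ^+ 2) `^ delta.
    by rewrite -powR_mulrn ?(ltW (fp _))// -powRrM -powRD_gt0// t_delta powRr1 ?(ltW (fp _)).
  rewrite {1}E -(ler_pM2l (powR_gt0 delta c00)) mulrCA !mulrA divff ?mul1r ?gt_eqF ?powR_gt0//.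
  by rewrite -mulrA ler_wpM2l ?powR_ge0.
elim: v => [|i v IH].
  rewrite big_nil expr0 mulr1 /Y !len_nil powR1 divff//.
rewrite big_cons /= -cat1s; apply: le_trans (Y_cat _ _) _.
rewrite exprS -[leLHS]mulr1.
have -> : K1 * K1 ^+ size v * (lenf [:: i] `^ t * \prod_(j <- v) lenf [:: j] `^ t) =
  CY * (((c0 `^ delta)^-1 * lenf [:: i] `^ t) * (K1 ^+ size v * \prod_(j <- v) lenf [:: j] `^ t)).
  by ring.
by rewrite mulr1 ler_pM2l//; apply: ler_pM => //; rewrite ltW.
Qed.

Let X_near v : lenf v / 2 <= leng v -> X v <= 2 * lenf v `^ ((tau - 1) * delta) * lenf v.
Proof.
move=> n1.
have h1 : lenf v `^ delta <= 2 * leng v `^ delta.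
  have : lenf v `^ delta <= 2 `^ delta * leng v `^ delta.
    rewrite -powRM ?(ltW (gp _))//; apply: powR_le => //; first exact: ltW.
    by rewrite mulrC -ler_pdivrMr.
  move=> /le_trans; apply; rewrite ler_pM2r ?powR_gt0//.
  rewrite -[leRHS](powRr1 (ler0n _ 2)); apply: ler_powR; first by rewrite ler1n.
  by have := t_delta; have := t0; lra.
rewrite /X /Y mulrAC ler_pdivrMr ?powR_gt0//.
have -> : tau * delta = (tau - 1) * delta + delta by ring.
rewrite powRD_gt0//.
set e := lenf v `^ _.
have -> : lenf v * (e * lenf v `^ delta) = e * lenf v * lenf v `^ delta by ring.
have -> : 2 * e * lenf v * leng v `^ delta = e * lenf v * (2 * leng v `^ delta) by ring.
by rewrite ler_wpM2l// mulr_ge0 ?powR_ge0 ?(ltW (fp _)).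
Qed.

Let sum_prod N : \sum_(v <- words N d) \prod_(i <- v) lenf [:: i] `^ t = powsum N ^+ d.
Proof. exact: (sum_words_prod N d (fun i => lenf [:: i] `^ t)). Qed.

Let size_words N v : v \in words N d -> size v = d.
Proof. by rewrite mem_words => /andP[/eqP]. Qed.

Let sum_Y N : \sum_(v <- words N d) Y v <= K1 ^+ d * P ^+ d.
Proof.
apply: (@le_trans _ _ (K1 ^+ d * powsum N ^+ d)).
  rewrite -sum_prod mulr_sumr big_seq [leRHS]big_seq; apply: ler_sum => v /size_words vd.
  by have := Y_letters v; rewrite vd.
rewrite ler_pM2l ?exprn_gt0// lerXn2r ?nnegrE ?powsumP//.
  by apply: sumr_ge0 => i _; exact: powR_ge0.
apply: le_trans (powsumP 0%N); by rewrite big_ord0.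
Qed.

(** Words with all letters below [N0] have comparable lengths, so [short] bounds their share by a
    quarter of their total length. The others are bounded through [Y_letters]; their products sum to
    a difference of powers of [powsum], made small by [tail]. *)
Let sum_X N : (N0 <= N)%N -> CX * \sum_(v <- words N d) X v <= 2^-1.
Proof.
move=> N0N; rewrite (bigID (all (fun i => i < N0)%N))/= mulrDr.
have -> : (2^-1 : R) = 4^-1 + 4^-1 by lra.
apply: lerD.
  rewrite sum_words_restrict// mulr_sumr.
  apply: (@le_trans _ _ (\sum_(v <- words N0 d) 4^-1 * lenf v)).
    rewrite big_seq [leRHS]big_seq; apply: ler_sum => v vN.
    apply: (@le_trans _ _ (CX * (2 * lenf v `^ ((tau - 1) * delta) * lenf v))).
      by rewrite ler_pM2l//; exact/X_near/near.
    by rewrite mulrA ler_pM2r//; exact: short (size_words vN).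
  by rewrite -mulr_sumr ler_piMr ?invr_ge0// (sum_words_len_le1 Hf).
apply: le_trans (tail N0N); rewrite ler_pM2l//.
apply: (@le_trans _ _ (\sum_(v <- words N d | ~~ all (fun i => i < N0)%N v)
    K1 ^+ d * \prod_(i <- v) lenf [:: i] `^ t)).
  rewrite big_seq_cond [leRHS]big_seq_cond; apply: ler_sum => v /andP[/size_words vd _].
  by apply: le_trans (X_le_Y v) _; have := Y_letters v; rewrite vd.
rewrite -mulr_sumr ler_pM2l ?exprn_gt0// -!sum_prod.
by rewrite [X in _ <= X - _](bigID (all (fun i => i < N0)%N))/= sum_words_restrict// addrAC subrr add0r.
Qed.

Let KY := CY * (K1 ^+ d * P ^+ d).
(** Chosen so that [c1] to the power [delta], times [KY], is at most 1/8 ([c1_delta]), half of what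
    [weight_sum] can spare. *)
Let c1 := (8 * (KY + 1))^-1 `^ delta^-1.

Let KY0 : 0 <= KY.
Proof.
rewrite mulr_ge0 ?(ltW CY0)// mulr_ge0 ?exprn_ge0 ?(ltW K10)//.
by apply: le_trans (powsumP 0%N); rewrite big_ord0.
Qed.

Let c10 : 0 < c1. Proof. by rewrite powR_gt0// invr_gt0 mulr_gt0// ltr_wpDl. Qed.

Let c1_le1 : c1 <= 1.
Proof.
have := @powR_le (8 * (KY + 1))^-1 1 delta^-1; rewrite powR1; apply.
- by rewrite invr_gt0.
- by rewrite invr_ge0 mulr_ge0// addr_ge0.
- by rewrite invf_le1 ?mulr_gt0 ?ltr_wpDl//; have := KY0; lra.
Qed.

Let c1_delta : c1 `^ delta * KY <= 8^-1.
Proof.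
rewrite /c1 -powRrM mulVf ?gt_eqF// powRr1 ?invr_ge0 ?mulr_ge0 ?addr_ge0//.
by rewrite mulrC ler_pdivrMr ?mulr_gt0 ?ltr_wpDl//; have := KY0; lra.
Qed.

(* Along a good sequence the first condition bounds the difference quotients of
   [h] from below, the second one is the Hoelder condition on [h]. *)
Let bad u v : bool :=
  (4 * lenf (u ++ v) < leng (u ++ v)) || (leng (u ++ v) < c1 * lenf u `^ tau).

Let weight u := 4^-1 * leng u + 4^-1 * X u.

(** [weight] is a supermartingale stopped at bad words. If [b > 4 * a], the term [b / 4] dominates
    the lost length. In the other bad case [lenf (u ++ v)] is [Y (u ++ v)] times a power of
    [leng (u ++ v)], hence at most [c1 ^ delta * CY * X u * Y v]. The terms with [X u] sum to
    [X u / 8 + X u / 8]. *)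
Let weight_sum N u : (N0 <= N)%N ->
  \sum_(v <- words N d) (if bad u v then lenf (u ++ v) else weight (u ++ v)) <= weight u.
Proof.
move=> N0N.
apply: (@le_trans _ _ (\sum_(v <- words N d) (4^-1 * leng (u ++ v) +
    (c1 `^ delta * (CY * X u) * Y v + 4^-1 * (CX * X u) * X v)))).
  apply: ler_sum => v _.
  have h1 : X (u ++ v) <= CX * X u * X v by rewrite -(mulrA CX).
  have h2 : 0 <= c1 `^ delta * (CY * X u) * Y v.
    apply: mulr_ge0 (ltW (Y0 v)); apply: mulr_ge0; first exact: powR_ge0.
    by rewrite ltW// mulr_gt0.
  have h3 := X0 (u ++ v); have h4 := gp (u ++ v).
  have [/orP[b1|b2]|_] := boolP (bad u v).
  - by lra.
  - have : lenf (u ++ v) <= c1 `^ delta * (CY * X u) * Y v; last by lra.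
    have h5 : leng (u ++ v) `^ delta <= c1 `^ delta * lenf u `^ (tau * delta).
      rewrite powRrM -powRM ?(ltW c10) ?powR_ge0//; apply: powR_le => //; exact: ltW.
    have := Y_cat u v; rewrite {1}/Y ler_pdivrMr ?powR_gt0// => /le_trans; apply.
    have -> : c1 `^ delta * (CY * X u) * Y v =
      CY * (Y u * Y v) * (c1 `^ delta * lenf u `^ (tau * delta)) by rewrite /X; ring.
    by rewrite ler_wpM2l// mulr_ge0 ?(ltW CY0)// mulr_ge0 ?(ltW (Y0 _)).
  - rewrite /weight; lra.
rewrite !big_split /= -!mulr_sumr /weight; apply: lerD.
  by rewrite ler_pM2l// (sum_words_len_le Hg).
have h1 := sum_Y N; have h2 := sum_X N0N; have h3 := X0 u.
have h4 : c1 `^ delta * (CY * X u) * \sum_(v <- words N d) Y v <= 8^-1 * X u.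
  apply: (@le_trans _ _ (c1 `^ delta * (CY * X u) * (K1 ^+ d * P ^+ d))).
    by rewrite ler_wpM2l// mulr_ge0 ?powR_ge0// mulr_ge0 ?(ltW CY0) ?(ltW h3).
  have -> : c1 `^ delta * (CY * X u) * (K1 ^+ d * P ^+ d) = (c1 `^ delta * KY) * X u.
    by rewrite /KY; ring.
  by rewrite ler_pM2r.
have h5 : 4^-1 * (CX * X u) * \sum_(v <- words N d) X v <= 8^-1 * X u.
  have -> : 4^-1 * (CX * X u) * (\sum_(v <- words N d) X v) =
    4^-1 * (CX * (\sum_(v <- words N d) X v)) * X u by ring.
  by rewrite ler_pM2r//; lra.
lra.
Qed.

(** Stopping at the first bad block keeps the removed cylinders from being counted again at deeper
    levels. Bounds on the alphabet and on the depth keep the union finite; [Z] lets both grow. *)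
Let Fixpoint bad_set N L u : set R :=
  if L is L'.+1 then \big[setU/set0]_(v <- words N d)
    (if bad u v then comp_word f (u ++ v) @` `[0, 1] else bad_set N L' (u ++ v))
  else set0.

Let measurable_bad_set N L u : measurable (bad_set N L u).
Proof.
elim: L u => [|L IH] u /=; first exact: measurable0.
by apply: bigsetU_measurable => v _; case: ifP => _; [exact: (measurable_cylinder Hf)|exact: IH].
Qed.

Let mu_bad_set N L u : (N0 <= N)%N -> (mu (bad_set N L u) <= (weight u)%:E)%E.
Proof.
move=> N0N; elim: L u => [|L IH] u /=.
  rewrite measure0 lee_fin /weight; have := gp u; have := X0 u; lra.
apply: le_trans (_ : ((\sum_(v <- words N d)
    (if bad u v then lenf (u ++ v) else weight (u ++ v)))%:E <= _)%E); last first.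
  by rewrite lee_fin weight_sum.
have m v : measurable (if bad u v then comp_word f (u ++ v) @` `[0, 1] else bad_set N L (u ++ v)).
  by case: ifP => _; [exact: (measurable_cylinder Hf)|exact: measurable_bad_set].
elim: (words N d) => [|v A IHA]; first by rewrite !big_nil measure0.
rewrite !big_cons EFinD.
apply: lebesgue_measureU_le IHA => //; first exact: bigsetU_measurable.
by case: ifP => _; [rewrite (lebesgue_measure_cylinder Hf)|exact: IH].
Qed.

Let bad_set_mono N N' L L' u : (N <= N')%N -> (L <= L')%N ->
  bad_set N L u `<=` bad_set N' L' u.
Proof.
move=> NN; elim: L L' u => [|L IH] [|L'] u // LL; rewrite /=.
- exact: sub0set.
- exact: sub0set.
rewrite -!bigcup_seq => y [v /= vN Hy]; exists v => /=.
  move: vN; rewrite !mem_words => /andP[-> /allP H]; apply/allP => i /H /= iN.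
  exact: leq_trans iN NN.
by case: ifP Hy => // _; exact: IH.
Qed.

Let Z : set R := \bigcup_n bad_set (N0 + n) n [::].

Let measurable_Z : measurable Z.
Proof. by apply: bigcup_measurable => n _; exact: measurable_bad_set. Qed.

Let mu_Z : (mu Z <= 2^-1%:E)%E.
Proof.
have w0 : weight [::] = 2^-1.
  by rewrite /weight /X /Y !len_nil !powR1 divr1 !mulr1; lra.
have mono : {homo (fun n => bad_set (N0 + n) n [::]) : n m / (n <= m)%N >-> (n <= m)%O}.
  by move=> n m nm; apply/subsetPset; apply: bad_set_mono; rewrite ?leq_add2l.
have c := @nondecreasing_cvg_mu _ _ _ mu _ (fun n => measurable_bad_set (N0 + n) n [::]) measurable_Z mono.
rewrite -(cvg_lim _ c)//; apply: lime_le; first exact: (cvgP _ c).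
by near=> n; rewrite -w0; apply: mu_bad_set; rewrite leq_addr.
Unshelve. all: by end_near. Qed.

(** Induction on the number [j] of blocks between the current prefix and the bad one: an earlier bad
    block on the way already puts the whole cylinder, and so [y], into the set. *)
Let mem_bad_set (w : nat -> nat) y N j m :
  (forall n, exists2 z, z \in `[0, 1] & y = comp_word f (mkseq w n) z) ->
  (forall i, (i < (m + j).+1 * d)%N -> (w i < N)%N) ->
  bad (mkseq w ((m + j) * d)) (mkseq (fun i => w ((m + j) * d + i)%N) d) ->
  bad_set N j.+1 (mkseq w (m * d)) y.
Proof.
move=> Hw; elim: j m => [|j IH] m wN Hb; rewrite [bad_set _ _ _]/= -bigcup_seq;
  exists (mkseq (fun i => w (m * d + i)%N) d) => /=.
- rewrite mem_words size_mkseq eqxx /=; apply/allP => _ /mapP[i + ->].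
  by rewrite mem_iota => /andP[_ id]; apply: wN; rewrite addn0 mulSn addnC ltn_add2r.
- move: Hb; rewrite addn0 => ->; rewrite -mkseqD.
  by have [z z01 ->] := Hw (m * d + d)%N; exists z.
- rewrite mem_words size_mkseq eqxx /=; apply/allP => _ /mapP[i + ->].
  rewrite mem_iota => /andP[_ id]; apply: wN; rewrite -(addnS m) mulnDl ltn_add2l.
  exact: leq_trans id (leq_pmull d (ltn0Sn _)).
- rewrite -mkseqD; case: ifP => _.
    by have [z z01 ->] := Hw (m * d + d)%N; exists z.
  by rewrite addnC -mulSn; apply: IH; rewrite addSnnS.
Qed.

Lemma typical_dim :
  (s%:E <= hausdorff_dim [set x | (x \in `[0, 1] /\ ~ has_deriv01 h x 0)%R])%E.
Proof.
have [p Hp] : {p : R -> R & forall y, y \in `[0, 1] -> p y \in `[0, 1] /\ h (p y) = y}.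
  apply: (@choice _ _ (fun y x => y \in `[0, 1] -> x \in `[0, 1] /\ h x = y)) => y.
  have [y01|y01] := boolP (y \in `[0, 1]); last by exists 0.
  by have [x x01 hx] := conjugacy_surj Hh y01; exists x.
(* The countable set of points to which [exists_coding] does not apply. *)
pose D : set R := range (fun u => comp_word f u 0).
have cD : countable D.
  by apply: (sub_countable (card_image_le _ _)); exact: countableP.
have D0 : mu D = 0%E by exact: countable_lebesgue_measure0.
have mD : measurable D by apply: countable_measurable => // ? _; exact: measurable_set1.
have good y : 0 <= y <= 1 -> ~ (Z `|` D) y -> exists w : nat -> nat,
    (forall n, exists2 z, z \in `[0, 1] & y = comp_word f (mkseq w n) (h z) /\
       p y = comp_word g (mkseq w n) z) /\
    forall n, ~~ bad (mkseq w (n * d)) (mkseq (fun i => w (n * d + i)%N) d).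
  rewrite -in01 => y01 yZD.
  have [|w Hw] := exists_coding Hf y01; first by move=> u yu; apply: yZD; right; exists u.
  exists w; split=> n.
    have [z z01 yE] := Hw n; have [z' z'01 zE] := conjugacy_surj Hh z01.
    exists z'; rewrite // zE; split=> //.
    have [p01 hp] := Hp y y01.
    have g01 := comp_word01 Hg (mkseq w n) z'01.
    have E : h (p y) = h (comp_word g (mkseq w n) z').
      by rewrite hp (conjugacy_comp_word Hg Hf Hh)// zE.
    by case: (ltgtP (p y) (comp_word g (mkseq w n) z')) => // /(conjugacy_lt Hh) H;
      [have := H p01 g01|have := H g01 p01]; rewrite E ltxx.
  apply/negP => Hb; apply: yZD; left.
  (* [M] exceeds every letter read up to the bad block, so a member of the union with alphabet at
     least [M] and depth at least [n.+1] catches [y]. *)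
  pose M := (\max_(i < n.+1 * d) w i).+1.
  exists (M + n.+1)%N => //.
  apply: (@bad_set_mono M _ n.+1 _ [::]); rewrite ?leq_addl//.
    by rewrite addnCA leq_addr.
  apply: (@mem_bad_set w y M n 0) => //.
  by move=> i; rewrite add0n => id; rewrite ltnS (leq_bigmax (Ordinal id)).
have cs0 : 0 < c1 `^ s by rewrite powR_gt0.
apply: (@hausdorff_dim_ge _ s (4 / c1 `^ s) _ (Z `|` D) p) => //.
- by rewrite divr_ge0 ?(ltW cs0).
- exact: measurableU.
- by rewrite -[leRHS]adde0; apply: lebesgue_measureU_le => //; rewrite D0.
- move=> y y01 yZD; have [w [Hw Hb]] := good y y01 yZD.
  rewrite -in01 in y01; have [p01 hp] := Hp y y01; split=> //.
  apply: (not_deriv0 Hg Hf Hh (ltr0Sn _ 3) p01) => e /(len_small Hg)[N HN].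
  have [z z01 [_ E]] := Hw (N.+1 * d)%N.
  exists (mkseq w (N.+1 * d)), z; split=> //.
    by apply: HN; rewrite size_mkseq (leq_trans _ (leq_pmulr _ d0)).
  have := Hb N; rewrite negb_or -mkseqD addnC -mulSn => /andP[]; rewrite -leNgt//.
move=> a r; rewrite le_eqVlt => /predU1P[<-|r0].
  exists [set h a]; rewrite lebesgue_measure_set1 lee_fin; split=> //.
    by rewrite mulr_ge0 ?powR_ge0// divr_ge0 ?(ltW cs0).
  rewrite addr0 => y y01 _ /le_anti ->; rewrite -in01 in y01.
  by have [_ ->] := Hp y y01.
have [r1|r1] := leP 1 r.
  exists `[0%R, 1%R]%classic; split=> [|| y y01 _ _]; first exact: measurable_itv.
    rewrite lebesgue_measure_itv/= lte_fin ltr01 oppr0 adde0 lee_fin.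
    have rs : 1 <= r `^ s by have := powR_le s0 ler01 r1; rewrite powR1.
    have cs : c1 `^ s <= 1 by have := powR_le s0 (ltW c10) c1_le1; rewrite powR1.
    apply: mulr_ege1 => //; rewrite ler_pdivlMr//; lra.
  by rewrite /= in_itv.
(* The bound on [lenf] at the last prefix whose [leng] exceeds [r]: goodness gives
   [c1 * lenf ^ tau <= r] there, and [s] is the inverse of [tau]. *)
pose rho := (r / c1) `^ s.
have rho0 : 0 <= rho by exact: powR_ge0.
pose W b : set R := `[h b - rho, h b + rho]%classic.
have mW b : measurable (W b) by exact: measurable_itv.
have muW b : (mu (W b) <= (2 * rho)%:E)%E.
  rewrite lebesgue_measure_itv/=; case: ifP => _; last by rewrite lee_fin mulr_ge0.
  by rewrite -EFinB lee_fin; lra.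
exists (W a `|` W (a + r)); split; first exact: measurableU.
- apply: le_trans (lebesgue_measureU_le (mW _) (mW _) (muW _) (muW _)) _; rewrite -EFinD lee_fin.
  have -> : 4 / c1 `^ s * r `^ s = 4 * rho.
    rewrite /rho powRM ?invr_ge0 ?(ltW r0) ?(ltW c10)//.
    by rewrite -[c1^-1]powR_inv1 ?(ltW c10)// -powRrM mulN1r powRN; ring.
  lra.
move=> y y01 yZD apr; have [w [Hw Hb]] := good y y01 yZD.
have [n [nr rn]] : exists n, r < leng (mkseq w (n * d)) /\ leng (mkseq w (n.+1 * d)) <= r.
  have /ex_minnP[[|n] nd minn] : exists n, leng (mkseq w (n * d)) <= r.
    have [N HN] := len_small Hg r0; exists N; apply/ltW/HN.
    by rewrite size_mkseq leq_pmulr.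
  - by move: nd; rewrite mul0n len_nil leNgt r1.
  - by exists n; split=> //; rewrite ltNge; apply/negP => /minn; rewrite ltnn.
have lrho : lenf (mkseq w (n * d)) <= rho.
  have := Hb n; rewrite negb_or -mkseqD addnC -mulSn => /andP[_].
  rewrite -leNgt => /le_trans/(_ rn); rewrite mulrC -ler_pdivlMr// => hh.
  have := powR_le s0 (powR_ge0 _ _) hh; rewrite -powRrM mulVf ?gt_eqF//.
  by rewrite powRr1 ?(ltW (fp _)).
have [z z01 [yE pE]] := Hw (n * d)%N.
rewrite pE in apr.
have [b [z' [bE z'01 Eb]]] := cylinder_meets_end Hg z01 apr nr.
have Wb : W b y.
  rewrite /W /= in_itv/= -Eb (conjugacy_comp_word Hg Hf Hh)// yE.
  have := comp_word_dist_le Hf (mkseq w (n * d)) (conjugacy01 Hh z01) (conjugacy01 Hh z'01).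
  by rewrite ler_norml; lra.
by case: bE Wb => -> Wb; [left|right].
Qed.

End LebesgueTypical.

(** * Conclusion *)

Lemma exists_nneg_bound (R : realType) (x : \bar R) : (x < +oo)%E ->
  exists2 V : R, 0 <= V & (x <= V%:E)%E.
Proof.
case: x => [r||] // _; last by exists 0; rewrite ?leNye.
by exists `|r| => //; rewrite lee_fin ler_norm.
Qed.

Lemma monotone_bounded_gap (R : realType) (a : nat -> R) (B eta : R) :
  {homo a : n m / (n <= m)%N >-> n <= m} -> (forall n, a n <= B) -> 0 < eta ->
  exists N, forall n, (N <= n)%N -> a n - a N <= eta.
Proof.
move=> am aB eta0; have hs : has_sup (range a).
  by split; [exists (a 0%N), 0%N|exists B => _ [n _ <-]].
have [_ [N _ <-] HN] := sup_adherent eta0 hs; exists N => n _.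
have : a n <= sup (range a) by apply: ub_le_sup; [case: hs|exists n].
move: HN; lra.
Qed.

Section Main.
Context {R : realType} {o : orientation}.
Context {T : R -> R} {f : nat -> R -> R} {Tk : nat -> R -> R} {fk : nat -> nat -> R -> R}.
Context {theta : nat -> R -> R}.
Hypothesis Hf : countable_markov_map o T f.
Hypothesis Hk : forall k, countable_markov_map o (Tk k) (fk k).
Hypothesis finf : finite_potential f.
Hypothesis fink : forall k, finite_potential (fk k).
Variable V : R.
Hypothesis V0 : 0 <= V.
Hypothesis HV : (sum_variations (potential f) <= V%:E)%E.
Hypothesis HVk : forall k, (sum_variations (potential (fk k)) <= V%:E)%E.
Hypothesis Hth : forall k, conjugacy (Tk k) (fk k) T f (theta k).
Hypothesis fk_cvg : forall i x, x \in `[0, 1] -> fk k i x @[k --> \oo] --> f i x.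
Variables (t P : R).
Hypothesis t0 : 0 < t.
Hypothesis t1 : t < 1.
Hypothesis powsumP : forall N, \sum_(i < N) cylinder_length f [:: val i] `^ t <= P.

Let C1 : 1 <= expR V. Proof. by rewrite -(@expR0 R) ler_expR. Qed.

Let qf : quasi_multiplicative (expR V) (cylinder_length f).
Proof. by move=> u v; split; [exact: (len_cat_le Hf finf HV)|exact: (len_cat_ge Hf finf HV)]. Qed.

Let qk k : quasi_multiplicative (expR V) (cylinder_length (fk k)).
Proof. by move=> u v; split; [exact: (len_cat_le (Hk k) (fink k) (HVk k))|exact: (len_cat_ge (Hk k) (fink k) (HVk k))]. Qed.

(** The order matters: [d] is found first, from cylinders shrinking and [s^-1 > 1]; then [N0],
    depending on [d], from convergence of the power sums. Only [f] is involved, so neither depends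
    on [k]. *)
Lemma typical_constants (s delta K1 CX : R) : 0 < s -> s < 1 -> 0 < delta ->
  0 < K1 -> 0 < CX ->
  exists d N0, [/\ (0 < d)%N,
    forall v, size v = d ->
      CX * (2 * cylinder_length f v `^ ((s^-1 - 1) * delta)) <= 4^-1 &
    forall N, (N0 <= N)%N ->
      CX * (K1 ^+ d * ((\sum_(i < N) cylinder_length f [:: val i] `^ t) ^+ d -
        (\sum_(i < N0) cylinder_length f [:: val i] `^ t) ^+ d)) <= 4^-1].
Proof.
move=> s0 s1 delta0 K10 CX0.
set e := (s^-1 - 1) * delta.
have e0 : 0 < e by rewrite mulr_gt0// subr_gt0 invf_gt1.
have z0 : 0 < (8 * CX)^-1 by rewrite invr_gt0 mulr_gt0.
have [n Hn] := len_small Hf (powR_gt0 e^-1 z0).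
pose a N : R := \sum_(i < N) cylinder_length f [:: val i] `^ t.
have a0 N : 0 <= a N by apply: sumr_ge0 => i _; exact: powR_ge0.
have am : {homo a : n m / (n <= m)%N >-> n <= m}.
  move=> p q pq; rewrite /a -!(big_mkord xpredT (fun i => cylinder_length f [:: i] `^ t)).
  rewrite (big_cat_nat _ pq)//= lerDl sumr_ge0// => i _; exact: powR_ge0.
have eta0 : 0 < (4 * (CX * K1 ^+ n.+1))^-1 by rewrite invr_gt0 !mulr_gt0// exprn_gt0.
have [||N0 HN0] := @monotone_bounded_gap _ (fun N => a N ^+ n.+1) (P ^+ n.+1) _ _ _ eta0.
- by move=> p q pq; apply: lerXn2r; rewrite ?nnegrE//; exact: am.
- move=> p; apply: lerXn2r; rewrite ?nnegrE//; first exact: le_trans (a0 0%N) (powsumP 0%N).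
  exact: powsumP.
exists n.+1, N0; split=> // [v vn|N N0N].
- have : cylinder_length f v `^ e <= (8 * CX)^-1.
    have -> : (8 * CX)^-1 = ((8 * CX)^-1 `^ e^-1) `^ e.
      by rewrite -powRrM mulVf ?gt_eqF// powRr1// ltW.
    apply: ge0_ler_powR; rewrite ?nnegrE ?(ltW e0) ?powR_ge0 ?(ltW (len_gt0 Hf _))//.
    by apply/ltW/Hn; rewrite vn.
  move=> h; apply: (@le_trans _ _ (CX * (2 * (8 * CX)^-1))); first by rewrite !ler_pM2l.
  have -> : CX * (2 * (8 * CX)^-1) = 4^-1 by field; rewrite gt_eqF.
  exact: lexx.
- rewrite mulrA; apply: (@le_trans _ _ (CX * K1 ^+ n.+1 * (4 * (CX * K1 ^+ n.+1))^-1)).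
    by rewrite ler_wpM2l ?mulr_ge0 ?exprn_ge0 ?(ltW CX0) ?(ltW K10)//; exact: HN0.
  by rewrite invfM mulrCA divff ?mulr1// gt_eqF// mulr_gt0// exprn_gt0.
Qed.

Lemma eventually_dim_ge (s : R) : 0 < s -> s < 1 -> \forall k \near \oo,
  (s%:E <= hausdorff_dim [set x | (x \in `[0, 1] /\ ~ has_deriv01 (theta k) x 0)%R])%E.
Proof.
move=> s0 s1; pose C := expR V.
have C0 : 0 < C by exact: expR_gt0.
have a10 : 0 < cylinder_length f [:: 1%N] := len_gt0 Hf _.
set kappa := (2 * C)^-1 * (4 * C ^+ 8) ^- 4 * (cylinder_length f [:: 1%N] / (2 * C ^+ 3)).
have k0 : 0 < kappa^-1.
  by rewrite invr_gt0 !mulr_gt0 ?invr_gt0 ?exprn_gt0 ?mulr_gt0 ?exprn_gt0.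
have [n [A [rho [uA An rho0 Arho KA]]]] := exists_many_words Hf finf HV s0 s1 k0.
pose c0 := (4 * C ^+ 8)^-1; pose delta := (1 - t) / 2.
have c00 : 0 < c0 by rewrite invr_gt0 mulr_gt0// exprn_gt0.
have delta0 : 0 < delta by rewrite divr_gt0// subr_gt0.
pose CY := C * C `^ delta; pose K1 := CY / c0 `^ delta; pose CX := CY * C `^ (s^-1 * delta).
have CY0 : 0 < CY by rewrite mulr_gt0// powR_gt0.
have K10 : 0 < K1 by rewrite divr_gt0// powR_gt0.
have CX0 : 0 < CX by rewrite mulr_gt0// powR_gt0.
have [d [N0 [d0 short tail]]] := typical_constants s0 s1 delta0 K10 CX0.
(* One finite list prepares for both alternatives, since which of them holds may change with [k]. *)
have near := len_near Hf Hk fink HVk fk_cvg (([:: 1%N] :: A) ++ words N0 d).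
near=> k.
have Hnear : forall u, u \in ([:: 1%N] :: A) ++ words N0 d ->
  cylinder_length f u / 2 <= cylinder_length (fk k) u <= 2 * cylinder_length f u.
  by near: k.
have [[j Hj]|noj] := pselect (exists j,
    cylinder_length (fk k) [:: j] < c0 * cylinder_length f [:: j] ^+ 2).
- apply: (inserted_letter_dim (Hk k) Hf (Hth k) C1 (@qk k) qf s0 s1 uA An rho0 Arho KA _ Hj).
  by move=> u uA'; apply: Hnear; rewrite mem_cat uA'.
- apply: (@typical_dim _ _ _ _ _ _ _ (Hk k) Hf (Hth k) C c0 t s delta d N0 C1 (@qk k) qf
    c00 t0 delta0 _ s0 d0 _ short tail _ P powsumP).
  + by rewrite /delta; lra.
  + by move=> j; rewrite leNgt; apply/negP => h; apply: noj; exists j.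
  + move=> v vN; have vA : v \in ([:: 1%N] :: A) ++ words N0 d by rewrite mem_cat vN orbT.
    by case/andP: (Hnear v vA).
Unshelve. all: by end_near. Qed.

End Main.

Theorem theorem1p1 (R : realType) (o : orientation)
    (T : R -> R) (f : nat -> R -> R)
    (Tk : nat -> R -> R) (fk : nat -> nat -> R -> R)
    (theta : nat -> R -> R)
    (T_markov : countable_markov_map o T f)
    (T_finite : finite_potential f)
    (T_summable : summable_variations (potential f))
    (Tk_markov : forall k, countable_markov_map o (Tk k) (fk k))
    (Tk_finite : forall k, finite_potential (fk k))
    (length_summable : exists t : R, [/\ 0 < t, t < 1 &
       (\sum_(0 <= i <oo)
          poweR (@lebesgue_measure R (f i @` `[0%R, 1%R]%classic)) t < +oo)%E])
    (Tk_summable :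
       (ereal_sup [set sum_variations (potential (fk k)) | k in [set: nat]]
          < +oo)%E)
    (theta_conj : forall k, conjugacy (Tk k) (fk k) T f (theta k))
    (fk_cvg : forall i (x : R), x \in `[0, 1] -> fk k i x @[k --> \oo] --> f i x) :
  hausdorff_dim [set x | x \in `[0, 1] /\ ~ has_deriv01 (theta k) x 0]
    @[k --> \oo] --> (1%:E : \bar R).
Proof.
have [V1 V10 HV1] := exists_nneg_bound T_summable.
have [V2 V20 HV2] := exists_nneg_bound Tk_summable.
have [t [t0 t1 /exists_nneg_bound[P P0 HP]]] := length_summable.
have V0 : 0 <= V1 + V2 by rewrite addr_ge0.
have HV : (sum_variations (potential f) <= (V1 + V2)%:E)%E.
  by apply: le_trans HV1 _; rewrite lee_fin lerDl.
have HVk k : (sum_variations (potential (fk k)) <= (V1 + V2)%:E)%E.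
  apply: (@le_trans _ _ V2%:E); last by rewrite lee_fin lerDr.
  by apply: le_trans HV2; apply: ereal_sup_ubound; exists k.
have powsumP N : \sum_(i < N) cylinder_length f [:: val i] `^ t <= P.
  rewrite -lee_fin; apply: le_trans HP; rewrite -sumEFin.
  apply: (@le_trans _ _ (\sum_(0 <= i < N) poweR (@lebesgue_measure R (f i @` `[0%R, 1%R]%classic)) t)%E).
    rewrite big_mkord; apply: lee_sum => i _.
    by rewrite -poweR_EFin -(lebesgue_measure_cylinder T_markov).
  by apply: nneseries_lim_ge => i _ _; exact: poweR_ge0.
have dim_ge s := @eventually_dim_ge R o T f Tk fk theta T_markov Tk_markov T_finite Tk_finite
  (V1 + V2) V0 HV HVk theta_conj fk_cvg t P t0 t1 powsumP s.
have dim_le k : (hausdorff_dim [set x | (x \in `[0, 1] /\ ~ has_deriv01 (theta k) x 0)%R] <= 1)%E.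
  by apply: hausdorff_dim_le1 => x [].
have half0 : 0 < 2^-1 :> R by rewrite invr_gt0.
have half1 : 2^-1 < 1 :> R by rewrite invf_lt1 ?ltr1n.
have fin : \forall k \near \oo,
    hausdorff_dim [set x | (x \in `[0, 1] /\ ~ has_deriv01 (theta k) x 0)%R] \is a fin_num.
  near=> k; rewrite ge0_fin_numE; first exact: le_lt_trans (dim_le k) (ltry 1).
  apply: (@le_trans _ _ (2^-1)%:E); first by rewrite lee_fin ltW.
  by near: k; exact: dim_ge.
apply/fine_cvgP; split; first exact: fin.
apply/cvgrPdist_lt => e e0 /=.
(* The maximum with 1/2 keeps [s] positive when [e] is large. *)
pose s := Num.max 2^-1 (1 - e / 2).
have s0 : 0 < s by rewrite lt_max half0.
have s1 : s < 1 by rewrite gt_max half1 /=; lra.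
have se : 1 - e / 2 <= s by rewrite le_max lexx orbT.
near=> k.
have f1 : hausdorff_dim [set x | (x \in `[0, 1] /\ ~ has_deriv01 (theta k) x 0)%R] \is a fin_num.
  by near: k.
have g1 : (s%:E <= hausdorff_dim [set x | (x \in `[0, 1] /\ ~ has_deriv01 (theta k) x 0)%R])%E.
  by near: k; exact: dim_ge.
have l1 := dim_le k; rewrite -(fineK f1) !lee_fin in g1 l1.
rewrite ger0_norm ?subr_ge0//; lra.
Unshelve. all: by end_near. Qed.
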